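(* A Finsler metric is uniquely determined by its coangle and its volume form. That is, let $F$ and $F_1$ be two Finsler metrics on an oriented $n$-manifold $M$, with coangle forms $\beta$, $\beta_1$ and associated volume forms $\Omega$, $\Omega_1$ respectively. If $\beta=\beta_1$ on $VH^*M$ and $\Omega=\Omega_1$, then $F=F_1$.
   Context: A Finsler metric on $M$ is a continuous function $F\colon TM\to[0,\infty)$ that is $C^\infty$ off the zero section, satisfies $F(x,\lambda v)=\lambda F(x,v)$ for $\lambda>0$, satisfies $F(x,v)\ge 0$ with equality iff $v=0$, and is strongly convex: $\left(\frac{\partial^2F^2}{\partial v_i\partial v_j}\right)_{i,j}$ is positive definite (off the zero section). Let $HM=(TM\smallsetminus\{0\})/\mathbb{R}^+_*$ and $H^*M=(T^*M\smallsetminus\{0\})/\mathbb{R}^+_*$, with projections $r\colon TM\smallsetminus\{0\}\to HM$, $\pi\colon HM\to M$, $\hat\pi\colon H^*M\to M$, and $VH^*M=\ker d\hat\pi$. The Hilbert form $A$ of $F$ is the $1$-form on $HM$ given by $A_{(x,\xi)}(Z)=\lim_{\epsilon\to0}\frac{1}{\epsilon}\left(F(x,v+\epsilon\, d\pi(Z))-F(x,v)\right)$ for any $v$ with $r(x,v)=(x,\xi)$. The Legendre transform $\ell_F\colon HM\to H^*M$ is the diffeomorphism sending $(x,\xi)$ to the class of the linear form $u\mapsto A_{(x,\xi)}(Z)$ on $T_xM$, where $d\pi(Z)=u$ (well defined since $A$ vanishes on $\ker d\pi$). Put $B=(\ell_F^{-1})^*A$, a contact form on $H^*M$. The coangle $\beta=\beta^{F^*}$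 is an $(n-1)$-form on $H^*M$, never zero on $VH^*M$, and $\Omega$ is the unique volume form on $M$, such that $\beta\wedge\hat\pi^*\Omega=B\wedge dB^{n-1}$ and $\int_{H_x^*M}\beta=\mathrm{vol}_{\mathrm{Eucl}}(\mathbb{S}^{n-1})$ for all $x\in M$ (orientations chosen compatibly); $\beta$ is uniquely determined on $VH^*M$. The volume form $\Omega$ coincides with the volume form $\Omega^F$ defined by the analogous decomposition $\alpha^F\wedge\pi^*\Omega^F=A\wedge dA^{n-1}$, $\int_{H_xM}\alpha^F=\mathrm{vol}_{\mathrm{Eucl}}(\mathbb{S}^{n-1})$, on $HM$. *)

(* Defs.v *)
From HB Require Import structures.
From mathcomp Require Import all_boot all_order all_algebra perm.
From mathcomp Require Import all_classical all_reals all_analysis.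

Set Implicit Arguments.
Unset Strict Implicit.
Unset Printing Implicit Defensive.

Import Order.TTheory GRing.Theory Num.Theory.
Import numFieldNormedType.Exports.

Local Open Scope classical_set_scope.
Local Open Scope ring_scope.

Section smoothness.
Context {R : realType} {V W : normedModType R}.

Fixpoint iter_derive (vs : seq V) (f : V -> W) : V -> W :=
  if vs is v :: vs' then fun x => 'D_v (iter_derive vs' f) x else f.

(* C^infinity on the open set U of a finite-dimensional V: all the iterated
   directional derivatives are Frechet differentiable at the points of U. *)
Definition smooth_on (U : set V) (f : V -> W) :=
  forall (vs : seq V) (x : V), U x -> differentiable (iter_derive vs f) x.

End smoothness.

(* Only the values of [to] on [dom] and of [from] on [to @` dom] matter. *)
Record chart (X E : Type) := Chart {
  dom : set X;
  to : X -> E;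
  from : E -> X }.

(* An atlas is given as a family of charts [ch : X -> chart X E] indexed by the
   points, [ch p] being a chart around p.  The tangent space of X at p is then
   the model space E, a tangent vector being identified with its components in
   the chart [ch p]. *)
Section charted.
Context {R : realType}.
Implicit Types E : normedModType R.

Definition tangent_map {X Y : Type} {E E'} (chX : X -> chart X E)
    (chY : Y -> chart Y E') (f : X -> Y) (p : X) : E -> E' :=
  'd (to (chY (f p)) \o f \o from (chX p)) (to (chX p) p).

(* Multilinearity, alternation and smoothness of a k-form are required
   separately, by [is_form]. *)
Definition kform (E : Type) (k : nat) := ('I_k -> E) -> R.
Definition dform (X E : Type) (k : nat) := X -> kform E k.

Definition multilinear {E} k (a : kform E k) :=
  forall (w : 'I_k -> E) (i : 'I_k) (c : R) (u v : E),
    a [eta w with i |-> c *: u + v] =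
    c * a [eta w with i |-> u] + a [eta w with i |-> v].

Definition alternate {E} k (a : kform E k) :=
  forall (w : 'I_k -> E) (i j : 'I_k), i != j -> w i = w j -> a w = 0.

Definition wedge {E : Type} k l (a : kform E k) (b : kform E l) :
    kform E (k + l)%N :=
  fun w => (k`! * l`!)%N%:R^-1 *
    \sum_(s : 'S_(k + l)%N) (-1) ^+ s *
      a (fun i => w (s (lshift l i))) * b (fun j => w (s (rshift k j))).

Fixpoint wedge_pow {E : Type} (a : kform E 2%N) (k : nat) {struct k} :
    kform E (k * 2)%N :=
  if k is k'.+1 then wedge a (@wedge_pow E a k') else fun=> 1.

(* the expression of omega in the chart [ch p], on constant vector fields *)
Definition local_form {X : Type} {E} (ch : X -> chart X E) k
    (omega : dform X E k) (p : X) (a : E) : kform E k :=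
  fun w => omega (from (ch p) a)
    (fun i => 'd (to (ch (from (ch p) a)) \o from (ch p)) a (w i)).

Definition is_form {X : Type} {E} (ch : X -> chart X E) k
    (omega : dform X E k) :=
  [/\ forall p, multilinear (omega p),
      forall p, alternate (omega p) &
      forall p w, smooth_on (to (ch p) @` dom (ch p))
        (fun a => local_form ch omega p a w)].

Definition pullback {X Y : Type} {E E'} (chX : X -> chart X E)
    (chY : Y -> chart Y E') (f : X -> Y) k (omega : dform Y E' k) :
    dform X E k :=
  fun p w => omega (f p) (fun i => tangent_map chX chY f p (w i)).

Definition ext_deriv {X : Type} {E} (ch : X -> chart X E) k
    (omega : dform X E k) : dform X E k.+1 :=
  fun p w => \sum_(i < k.+1) (-1) ^+ i *
    'D_(w i) (fun a => local_form ch omega p a (fun j => w (lift i j)))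
      (to (ch p) p).

End charted.
Arguments kform : clear implicits.
Arguments dform : clear implicits.
Arguments wedge_pow {R E} a k.

(* Hausdorff, second countable smooth n-manifold, oriented by an atlas whose
   changes of coordinates have positive Jacobian determinants. *)
Record oriented_manifold (R : realType) (n : nat) (M : topologicalType)
    (ch : M -> chart M 'rV[R]_n) : Prop := OrientedManifold {
  om_hausdorff : hausdorff_space M;
  om_countable : @second_countable M;
  om_at : forall x, dom (ch x) x;
  om_dom_open : forall x, open (dom (ch x));
  om_im_open : forall x, open (to (ch x) @` dom (ch x));
  om_toK : forall x y, dom (ch x) y -> from (ch x) (to (ch x) y) = y;
  om_to_cont : forall x, {within dom (ch x), continuous (to (ch x))};
  om_from_cont : forall x,
    {within to (ch x) @` dom (ch x), continuous (from (ch x))};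
  om_smooth : forall x y,
    smooth_on (to (ch x) @` (dom (ch x) `&` dom (ch y)))
      (to (ch y) \o from (ch x));
  om_oriented : forall x y z, (dom (ch x) `&` dom (ch y)) z ->
    0 < \det ('J (to (ch y) \o from (ch x)) (to (ch x) z)) }.

(* Rays: the quotient of R^(m+1) minus 0 by the positive dilations. *)
Section rays.
Context {R : realType} {m : nat}.

Definition nzvec := {v : 'rV[R]_m.+1 | v != 0}.

Definition ray_rel (u v : nzvec) : bool :=
  `[< exists2 l : R, 0 < l & val v = l *: val u >].

Lemma ray_rel_refl : reflexive ray_rel.
Proof. by move=> u; apply/asboolP; exists 1; rewrite ?scale1r. Qed.

Lemma ray_rel_imp u v : ray_rel u v -> ray_rel v u.
Proof.
move=> /asboolP[l l0 vE]; apply/asboolP; exists l^-1; first by rewrite invr_gt0.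
by rewrite vE scalerA mulVf ?scale1r// gt_eqF.
Qed.

Lemma ray_rel_sym : symmetric ray_rel.
Proof. by move=> u v; apply/idP/idP; apply: ray_rel_imp. Qed.

Lemma ray_rel_trans : transitive ray_rel.
Proof.
move=> v u w /asboolP[l l0 uE] /asboolP[k k0 vE]; apply/asboolP.
by exists (k * l); [exact: mulr_gt0 | rewrite vE uE scalerA].
Qed.

Canonical ray_equiv := EquivRel ray_rel ray_rel_refl ray_rel_sym ray_rel_trans.

Definition ray := {eq_quot ray_equiv}%qT.

Lemma const1_neq0 : (const_mx 1 : 'rV[R]_m.+1) != 0.
Proof.
by apply/eqP => /rowP/(_ ord0); rewrite !mxE => /eqP; rewrite oner_eq0.
Qed.

(* the ray of v, for v != 0 (a junk value if v = 0) *)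
Definition ray_of (v : 'rV[R]_m.+1) : ray :=
  (\pi_ray (insubd (Sub (const_mx 1) const1_neq0 : nzvec) v))%qT.

Definition ray_repr (r : ray) : 'rV[R]_m.+1 := val (repr r).

(* the vector with i-th component s and the others given by t *)
Definition affine_vec (i : 'I_m.+1) (s : R) (t : 'rV[R]_m) : 'rV[R]_m.+1 :=
  \row_j if unlift i j is Some k then t 0 k else s.

Definition pivot (v : 'rV[R]_m.+1) : 'I_m.+1 :=
  [arg max_(i > ord0) `|v 0 i|]%O.

End rays.
Arguments nzvec : clear implicits.
Arguments ray : clear implicits.

Section ray_bundles.
Context {R : realType} {m : nat} {M : choiceType}.
Variable ch : M -> chart M 'rV[R]_m.+1.

(* [tan_trans x y z], resp. [cotan_trans x y z], acts on the right on row
   vectors, sending the components with respect to the chart [ch x] of a tangent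
   vector, resp. a covector, at z to its components with respect to [ch y]; the
   pairing of a covector q and a vector v is q *m v^T. *)
Definition tan_trans (x y z : M) : 'M[R]_m.+1 :=
  'J (to (ch y) \o from (ch x)) (to (ch x) z).

Definition cotan_trans (x y z : M) : 'M[R]_m.+1 := (tan_trans y x z)^T.

(* Charts of HM (for tr = tan_trans) and of H^*M (for tr = cotan_trans): near a
   ray whose i-th component has sign s, a ray spanned at y by a vector with
   components w in [ch x] has coordinates the ones of y and the w_j / |w_i| for
   j != i. The point (x, r) stands for the ray at x spanned by the vector with
   components [ray_repr r] in [ch x]. *)
Definition ray_chart (tr : M -> M -> M -> 'M[R]_m.+1) (p : M * ray R m) :
    chart (M * ray R m) ('rV[R]_m.+1 * 'rV[R]_m)%type :=
  let x := p.1 in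
  let i := pivot (ray_repr p.2) in
  let s := Num.sg (ray_repr p.2 0 i) in
  let comps (q : M * ray R m) := ray_repr q.2 *m tr q.1 x q.1 in
  {| dom := [set q | dom (ch x) q.1 /\ 0 < s * comps q 0 i];
     to := fun q => (to (ch x) q.1, `|comps q 0 i|^-1 *: col' i (comps q));
     from := fun a => let y := from (ch x) a.1 in
       (y, ray_of (affine_vec i s a.2 *m tr x y y)) |}.

Definition HM_chart := ray_chart tan_trans.
Definition HsM_chart := ray_chart cotan_trans.

Definition HM_proj (p : M * ray R m) : M := p.1.
Definition HsM_proj (q : M * ray R m) : M := q.1.

Definition vertical (q : M * ray R m) (Z : 'rV[R]_m.+1 * 'rV[R]_m) :=
  tangent_map HsM_chart ch HsM_proj q Z = 0.

Fixpoint cube_integral (k : nat) : ('rV[R]_k -> R) -> R :=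
  if k is k'.+1 then fun f =>
    Rintegral lebesgue_measure `[-1, 1]
      (fun t : R => cube_integral (fun u : 'rV[R]_k' =>
        f (row_mx (const_mx t : 'rV[R]_1) u)))
  else fun f => f 0.

(* Integral of an m-form over the fibre at x of H^*M. The fibre is parametrised
   by the boundary of the cube [-1, 1]^(m+1) of T_x^*M, whose faces t_i = s carry
   the boundary orientation, of sign s (-1)^i in the coordinates t_j, j != i. *)
Definition fibre_integral (x : M) (beta : dform R (M * ray R m) _ m) : R :=
  \sum_(i < m.+1) \sum_(e : bool) (-1) ^+ e * (-1) ^+ i *
    let face (t : 'rV[R]_m) := (x, ray_of (affine_vec i ((-1) ^+ e) t)) in
    cube_integral (fun t => beta (face t)
      (fun j => 'd (to (HsM_chart (face t)) \o face) t (delta_mx 0 j))).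

End ray_bundles.

(* Euclidean volume of the unit sphere S^k of R^(k+1) *)
Fixpoint sphere_volume (R : realType) (k : nat) : R :=
  match k with
  | 0%N => 2
  | 1%N => 2 * pi
  | k'.+2 => 2 * pi / k'.+1%:R * sphere_volume R k'
  end.

Section finsler.
Context {R : realType} {m : nat} {M : topologicalType}.
Variable ch : M -> chart M 'rV[R]_m.+1.

(* A function F on TM is a function of x and of the components in [ch x] of a
   tangent vector at x; this is its expression in the coordinates of TM induced
   by [ch x]. *)
Definition TM_local (F : M -> 'rV[R]_m.+1 -> R) (x : M)
    (a : 'rV[R]_m.+1 * 'rV[R]_m.+1) : R :=
  let y := from (ch x) a.1 in F y (a.2 *m tan_trans ch x y y).

Definition hessian (f : 'rV[R]_m.+1 -> R) (v : 'rV[R]_m.+1) : 'M[R]_m.+1 :=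
  \matrix_(i, j)
    'D_(delta_mx 0 i : 'rV[R]_m.+1) ('D_(delta_mx 0 j : 'rV[R]_m.+1) f) v.

Record finsler (F : M -> 'rV[R]_m.+1 -> R) : Prop := Finsler {
  finsler_cont : forall x a, (to (ch x) @` dom (ch x)) a.1 ->
    {for a, continuous (TM_local F x)};
  finsler_smooth : forall x,
    smooth_on [set a | (to (ch x) @` dom (ch x)) a.1 /\ a.2 != 0]
      (TM_local F x);
  finsler_homog : forall x (l : R) v, 0 < l -> F x (l *: v) = l * F x v;
  finsler_ge0 : forall x v, 0 <= F x v;
  finsler_eq0 : forall x v, F x v = 0 <-> v = 0;
  finsler_convex : forall x v (u : 'rV[R]_m.+1), v != 0 -> u != 0 ->
    0 < (u *m hessian (fun w => F x w ^+ 2) v *m u^T) 0 0 }.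

(* HM and H^*M have the same points in these coordinates, but not the same
   charts. *)
Notation HM := (M * ray R m)%type.
Notation HsM := (M * ray R m)%type.
Notation E1 := ('rV[R]_m.+1 * 'rV[R]_m)%type.

(* the 1-form A on HM; 'D_u f v is the limit of (f (v + eps u) - f v) / eps *)
Definition hilbert (F : M -> 'rV[R]_m.+1 -> R) : dform R HM E1 1%N :=
  fun p Z => 'D_(tangent_map (HM_chart ch) ch (@HM_proj R m M) p (Z ord0))
    (F p.1) (ray_repr p.2).

(* The linear form u |-> A_p(Z), with Z any vector such that dpi(Z) = u, is
   given by its components on the canonical basis. *)
Definition legendre (F : M -> 'rV[R]_m.+1 -> R) (p : HM) : HsM :=
  let lift_vec (u : 'rV[R]_m.+1) : E1 :=
    xget 0 [set Z | tangent_map (HM_chart ch) ch (@HM_proj R m M) p Z = u] in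
  (p.1, ray_of (\row_i hilbert F p (fun=> lift_vec (delta_mx 0 i)))).

Definition legendre_inv (F : M -> 'rV[R]_m.+1 -> R) (q : HsM) : HM :=
  xget q [set p | legendre F p = q].

Definition contact_form (F : M -> 'rV[R]_m.+1 -> R) : dform R HsM E1 1%N :=
  pullback (HsM_chart ch) (HM_chart ch) (legendre_inv F) (hilbert F).

Definition volume_form (Omega : dform R M 'rV[R]_m.+1 m.+1) :=
  is_form ch Omega /\ forall x, 0 < Omega x (fun i => delta_mx 0 i).

(* beta is a coangle form and Omega the volume form associated with F.
   The two sides of the decomposition are (2m+1)-forms, of degrees m + (m+1) and
   1 + 2m; they are compared on the first 2m+1 terms of a sequence Z. The
   orientation of the fibres is the one that makes the integral of beta
   positive, M being oriented by Omega; hence the absolute value. *)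
Record coangle_volume (F : M -> 'rV[R]_m.+1 -> R) (beta : dform R HsM E1 m)
    (Omega : dform R M 'rV[R]_m.+1 m.+1) : Prop := CoangleVolume {
  coangle_form : is_form (HsM_chart ch) beta;
  coangle_neq0 : forall q, exists2 Z : 'I_m -> E1,
    (forall i, vertical ch q (Z i)) & beta q Z != 0;
  coangle_volume_form : volume_form Omega;
  coangle_decomp : forall q (Z : nat -> E1),
    wedge (beta q) (pullback (HsM_chart ch) ch (@HsM_proj R m M) Omega q)
      (fun i => Z i) =
    wedge (contact_form F q)
      (wedge_pow (ext_deriv (HsM_chart ch) (contact_form F) q) m)
      (fun i => Z i);
  coangle_integral : forall x,
    `|fibre_integral ch x beta| = sphere_volume R m }.

End finsler.

(* Main.v *)
(* On covectors the contact form of F at the ray spanned by p is B = p / F*(p),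
   where F* is the dual norm of F: a positive function g times a form theta which
   does not depend on F. On the kernel of theta, dB = g dtheta, so evaluating on
   a frame with all but one vector in that kernel gives
   B /\ dB^m = g^(m+1) theta /\ dtheta^m. The left-hand side only depends on the
   restriction of beta to vertical vectors and on Omega, and is nonzero; hence F
   and F1 have the same g, that is the same dual norm, and F = F1 by duality.

   The regularity of B is not derived from the smoothness of the Legendre
   transform: 'd f x is 0 where f is not differentiable, so that the
   decomposition, whose left-hand side is nonzero, forces the inverse Legendre
   transform to be differentiable. Likewise the smoothness and nonvanishing of
   beta force the changes of charts of H^*M to be differentiable. *)
From HB Require Import structures.
Require Import Defs.
From mathcomp Require Import all_boot all_order all_algebra perm.
From mathcomp Require Import all_classical all_reals all_analysis.
From mathcomp Require Import ring.

Set Implicit Arguments.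
Unset Strict Implicit.
Unset Printing Implicit Defensive.

Import Order.TTheory GRing.Theory Num.Theory.
Import numFieldNormedType.Exports.

Local Open Scope classical_set_scope.
Local Open Scope ring_scope.

(** * Differentials *)

Section calculus.
Context {R : realType}.
Implicit Types V W : normedModType R.

(** ['d f x] is chosen among the continuous linear maps that give a first-order expansion, with the
    zero map as default. *)
Lemma diff_eq0 {V W} (f : V -> W) x u : ~ differentiable f x -> 'd f x u = 0.
Proof.
move=> Nf; rewrite /diff getPN// => df [cdf fdf]; apply: Nf.
apply/diffP.
exact: (@getPex {linear V -> W} (fun df => continuous df /\ _)
  (ex_intro _ df (conj cdf fdf))).
Qed.

Lemma near_eq_differentiable {V W} (f g : V -> W) x :
  (\near x, f x = g x) -> differentiable f x -> differentiable g x.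
Proof.
move=> fg /diff_locallyP [cdf /eqaddoP fE].
suff gE : g \o shift x = cst (g x) + 'd f x +o_ (0 : V) id.
  by apply/diff_locallyP; rewrite (diff_unique cdf gE).
apply/eqaddoP => e e0; have := fE e e0; apply: filter_app.
have : \forall y \near (0 : V), f (y + x) = g (y + x).
  by have := fg; rewrite (near_shift 0 x)/=; apply: filterS => y /=; rewrite subr0.
by apply: filterS => y /=; rewrite !fctE/= => <-; rewrite (nbhs_singleton fg).
Qed.

(** If one function is not differentiable at [x], neither is the other, and both differentials are
    the default 0. *)
Lemma near_eq_diff {V W} (f g : V -> W) x :
  (\near x, f x = g x) -> 'd f x = 'd g x :> (V -> W).
Proof.
move=> fg; have gf : (\near x, g x = f x) by apply: filterS fg.
have [df|Nf] := pselect (differentiable f x).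
  have dg := near_eq_differentiable fg df.
  by apply/funext => u; rewrite -!deriveE//; apply: near_eq_derive.
apply/funext => u; rewrite !diff_eq0//.
by move=> dg; apply: Nf; exact: near_eq_differentiable gf dg.
Qed.

Lemma differentiable_fst {V W} (p : V * W) : differentiable fst p.
Proof. by apply: linear_differentiable => q; exact: cvg_fst. Qed.

Lemma differentiable_snd {V W} (p : V * W) : differentiable snd p.
Proof. by apply: linear_differentiable => q; exact: cvg_snd. Qed.

Lemma diff_fst {V W} (p u : V * W) : 'd fst p u = u.1.
Proof. by rewrite diff_lin// => q; exact: cvg_fst. Qed.

Lemma diff_comp_fst {V V' W} (f : V -> W * V') x u :
  differentiable f x -> ('d f x u).1 = 'd (fst \o f) x u.
Proof.
by move=> df; rewrite (diff_comp df (differentiable_fst (f x)))/= diff_fst.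
Qed.

Lemma derive_le0_of_le {V} (f : V -> R) (x u : V) : differentiable f x ->
  (forall h : R, f (h *: u + x) <= f x) -> 'D_u f x <= 0.
Proof.
move=> df fle; have dfu : derivable f x u by exact: diff_derivable.
have : (fun h => h^-1 *: ((f \o shift x) (h *: u) - f x)) @ 0^'+ --> 'D_u f x.
  apply: cvg_trans dfu; apply: cvg_app.
  by apply: within_subset => // y /= /gt_eqF/negbT.
move=> /cvgr_to_le; apply; near=> h => /=.
by rewrite mulr_ge0_le0// ?subr_le0// invr_ge0 ltW.
Unshelve. all: by end_near. Qed.
End calculus.

(** * Minkowski norms *)

Section line.
Context {R : realType} {V W : normedModType R}.

Let line_rate (g : V -> W) (v u : V) (t : R) :
  (fun h : R => h^-1 *: (((fun s : R => g (v + s *: u)) \o shift t) (h *: (1 : R)) -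
    g (v + t *: u))) =
  (fun h : R => h^-1 *: ((g \o shift (v + t *: u)) (h *: u) - g (v + t *: u))).
Proof. by apply/funext => h /=; rewrite [h *: 1]mulr1 scalerDl addrCA. Qed.

Lemma derive_line (g : V -> W) (v u : V) (t : R) :
  'D_1 (fun s : R => g (v + s *: u)) t = 'D_u g (v + t *: u).
Proof. by rewrite /derive line_rate. Qed.

Lemma derivable_line (g : V -> W) (v u : V) (t : R) :
  derivable g (v + t *: u) u -> derivable (fun s : R => g (v + s *: u)) t 1.
Proof. by rewrite /derivable line_rate. Qed.

End line.

Section taylor.
Context {R : realType} {V : normedModType R}.

(** First-order convexity inequality, by the mean value theorem used twice: for [g] between [v] and
    [v + u], then for ['D_u g] between [v] and the intermediate point. *)
Lemma derive_le_diff (g : V -> R) (v u : V) :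
  (forall t : R, differentiable g (v + t *: u)) ->
  (forall t : R, differentiable ('D_u g) (v + t *: u)) ->
  (forall t : R, 0 <= 'D_u ('D_u g) (v + t *: u)) ->
  'D_u g v <= g (v + u) - g v.
Proof.
move=> dg ddg ddg0.
have dline (h : V -> R) : (forall t : R, differentiable h (v + t *: u)) ->
    forall t, is_derive t (1 : R) (fun s : R => h (v + s *: u)) ('D_u h (v + t *: u)).
  move=> dh t; split; last exact: derive_line.
  by apply: derivable_line; exact: diff_derivable.
have cline (h : V -> R) a b : (forall t : R, differentiable h (v + t *: u)) ->
    {within `[a, b], continuous (fun s : R => h (v + s *: u))}.
  move=> dh; apply: continuous_subspaceT => t.
  apply: differentiable_continuous; apply/derivable1_diffP.
  exact: (@ex_derive _ _ _ _ _ _ _ (dline h dh t)).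
have [c c01 cE] := @MVT R _ _ 0 1 ltr01 (fun t _ => dline g dg t) (cline g _ _ dg).
have {cE} : g (v + u) - g v = 'D_u g (v + c *: u).
  by move: cE; rewrite scale1r scale0r addr0 subr0 mulr1.
move=> ->; have c0 : 0 < c by move: c01; rewrite in_itv/= => /andP[].
have [d _ dE] := @MVT R _ _ 0 c c0 (fun t _ => dline _ ddg t) (cline _ _ _ ddg).
rewrite -subr_ge0; move: dE; rewrite scale0r addr0 => ->.
by rewrite subr0 mulr_ge0// ltW.
Qed.

End taylor.

Section minkowski_norm.
Context {R : realType} {m : nat}.
Variable f : 'rV[R]_m.+1 -> R.
Hypothesis f_homog : forall (l : R) (v : 'rV[R]_m.+1), 0 < l -> f (l *: v) = l * f v.
Hypothesis f_ge0 : forall v, 0 <= f v.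
Hypothesis f_eq0 : forall v, f v = 0 <-> v = 0.
Hypothesis f_diff : forall v : 'rV[R]_m.+1, v != 0 -> differentiable f v.
Hypothesis f_diff2 : forall u v : 'rV[R]_m.+1, v != 0 -> differentiable ('D_u f) v.
Hypothesis f_convex : forall (v u : 'rV[R]_m.+1), v != 0 -> u != 0 ->
  0 < (u *m hessian (fun w => f w ^+ 2) v *m u^T) 0 0.

Lemma norm_gt0 (v : 'rV[R]_m.+1) : v != 0 -> 0 < f v.
Proof.
move=> v0; rewrite lt_neqAle f_ge0 andbT eq_sym.
by apply/eqP => /f_eq0/eqP; rewrite (negPf v0).
Qed.

(** Euler's identity: by homogeneity the difference quotient in the direction [v] equals [f v] as
    soon as [h + 1] is positive. *)
Lemma derive_euler (v : 'rV[R]_m.+1) : v != 0 -> 'D_v f v = f v.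
Proof.
move=> v0; apply/lim_near_cst => //=.
near=> h.
have h0 : h != 0 by near: h; exact: nbhs_dnbhs_neq.
have h1 : 0 < h + 1.
  rewrite -ltrBlDr sub0r; near: h; apply: nbhs_dnbhs; apply: lt_nbhsr.
  by rewrite ltrN10.
rewrite -[X in f (_ + X)](scale1r v) -scalerDl f_homog// mulrDl mul1r addrK.
by rewrite [_ *: _]mulrA mulVf// mul1r.
Unshelve. all: by end_near. Qed.

Lemma derive_scale (v u : 'rV[R]_m.+1) (c : R) : v != 0 -> 'D_(c *: u) f v = c * 'D_u f v.
Proof. by move=> v0; have df := f_diff v0; rewrite !deriveE// linearZ. Qed.

Lemma differentiable_norm_sqr (v : 'rV[R]_m.+1) : v != 0 ->
  differentiable (fun w => f w ^+ 2) v.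
Proof.
move=> v0; rewrite (_ : (fun w => f w ^+ 2) = f * f); last exact/funext.
by apply: differentiableM; exact: f_diff.
Qed.

Lemma derive_norm_sqr (u v : 'rV[R]_m.+1) : v != 0 ->
  'D_u (fun w => f w ^+ 2) v = 2 * f v * 'D_u f v.
Proof.
move=> v0; have fu : derivable f v u by apply: diff_derivable; exact: f_diff.
rewrite (_ : (fun w => f w ^+ 2) = f * f); last exact/funext.
by rewrite deriveM// -[LHS]/(f v * 'D_u f v + f v * 'D_u f v); ring.
Qed.

Lemma near_neq0 (v : 'rV[R]_m.+1) : v != 0 -> \forall w \near v, w != 0.
Proof.
move=> v0. have: (fun w : 'rV[R]_m.+1 => w) @ v --> v by exact: cvg_id.
by move=> /cvgr_neq0; apply.
Qed.

Lemma differentiable_derive_norm_sqr (u v : 'rV[R]_m.+1) : v != 0 ->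
  differentiable ('D_u (fun w => f w ^+ 2)) v.
Proof.
move=> v0; apply: (@near_eq_differentiable _ _ _ (fun w => 2 * f w * 'D_u f w)).
  by apply: filterS (near_neq0 v0) => w w0; rewrite derive_norm_sqr.
apply: differentiableM; last exact: f_diff2.
by apply: differentiableM; [exact: differentiable_cst | exact: f_diff].
Qed.

Lemma derive2_norm_sqr (u v : 'rV[R]_m.+1) : v != 0 ->
  'D_u ('D_u (fun w => f w ^+ 2)) v =
  (u *m hessian (fun w => f w ^+ 2) v *m u^T) 0 0.
Proof.
move=> v0; set E := fun w => f w ^+ 2.
have lin (h : 'rV[R]_m.+1 -> R) w : differentiable h w ->
    'D_u h w = \sum_i u 0 i * 'D_(delta_mx 0 i) h w.
  move=> dh; rewrite deriveE// {1}(row_sum_delta u) linear_sum.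
  by apply: eq_bigr => i _; rewrite linearZ deriveE.
have dE w : w != 0 -> differentiable E w by exact: differentiable_norm_sqr.
have ddE i : differentiable ('D_(delta_mx 0 i) E) v.
  exact: differentiable_derive_norm_sqr.
have -> : 'D_u ('D_u E) v = 'D_u (\sum_i u 0 i *: 'D_(delta_mx 0 i) E) v.
  apply: near_eq_derive; apply: filterS (near_neq0 v0) => w w0.
  by rewrite (lin _ _ (dE w w0)) fct_sumE; apply: eq_bigr => i _.
rewrite derive_sum; last first.
  by move=> i; apply: derivableZ; exact: diff_derivable.
rewrite mxE; apply: eq_bigr => j _.
rewrite deriveZ; last exact: diff_derivable.
rewrite (lin _ _ (ddE j)) [u^T _ _]mxE mulrC [in RHS]mxE; congr (_ * _).
by apply: eq_bigr => i _; rewrite mxE.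
Qed.

(** Fundamental inequality of Minkowski norms. Rescale [u] to [c *: u] with [f (c *: u) = f v];
    convexity of f^2 from [v] to [c *: u] makes its derivative at [v] nonpositive, and Euler's
    identity turns this into c D_u f(v) <= f(v) = c f(u). *)
Lemma derive_norm_le (v u : 'rV[R]_m.+1) : v != 0 -> 'D_u f v <= f u.
Proof.
(* Multiples of [v] are treated apart, since their line through [v] may meet 0. *)
move=> v0; have [[k ->]|Nk] := pselect (exists k : R, u = k *: v).
  rewrite derive_scale// derive_euler//.
  have [k0|k0] := ltP 0 k; first by rewrite f_homog.
  by rewrite (le_trans _ (f_ge0 _))// mulr_le0_ge0.
have u0 : u != 0.
  by apply/eqP => u0; apply: Nk; exists 0; rewrite scale0r.
have fv := norm_gt0 v0; have fu := norm_gt0 u0.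
(* f^2 is convex on the line through v and c u, which avoids 0. *)
pose c := f v / f u; have c0 : 0 < c by rewrite divr_gt0.
pose w := c *: u - v.
have line0 t : v + t *: w != 0.
  apply/eqP => vw; have [t0|t0] := eqVneq t 0.
    by move/eqP: vw; rewrite t0 scale0r addr0 (negPf v0).
  apply: Nk; exists ((t - 1) / (t * c)).
  have tc0 : t * c != 0 by rewrite mulf_neq0// gt_eqF.
  apply: (scalerI tc0).
  rewrite scalerA [X in _ = X *: _]mulrC divfK//.
  apply/subr0_eq; rewrite -[RHS]vw /w scalerBr scalerA scalerBl scale1r.
  by rewrite opprB addrA [RHS]addrC addrAC.
have : 'D_w (fun w => f w ^+ 2) v <= f (v + w) ^+ 2 - f v ^+ 2.
  apply: (derive_le_diff (fun s => differentiable_norm_sqr (line0 s))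
    (fun s => differentiable_derive_norm_sqr w (line0 s))) => s.
  rewrite derive2_norm_sqr//; apply/ltW/f_convex => //.
  by apply/eqP => w0; apply: Nk; exists c^-1;
    rewrite -(subr0_eq w0) scalerA mulVf ?scale1r// gt_eqF.
have -> : v + w = c *: u by rewrite /w addrC subrK.
rewrite derive_norm_sqr// /w f_homog// /c divfK ?gt_eqF// subrr.
have df := f_diff v0.
rewrite pmulr_rle0 ?mulr_gt0// deriveE// linearB/= -!deriveE//.
rewrite derive_euler// derive_scale// subr_le0 -/c => le1.
by rewrite -(ler_pM2l c0) (le_trans le1)// /c divfK// gt_eqF.
Qed.

End minkowski_norm.

(** * Dual norms *)

Section pairing.
Context {R : realType} {n : nat}.
Implicit Types p u v : 'rV[R]_n.

Definition pairing p u : R := (p *m u^T) 0 0.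

Lemma pairingE p u : pairing p u = \sum_i p 0 i * u 0 i.
Proof. by rewrite /pairing mxE; apply: eq_bigr => i _; rewrite mxE. Qed.

Lemma pairingZl c p u : pairing (c *: p) u = c * pairing p u.
Proof. by rewrite /pairing -scalemxAl mxE. Qed.

Lemma pairing_is_linear p : linear (pairing p).
Proof. by move=> c u v; rewrite /pairing linearP/= linearP/= !mxE. Qed.

HB.instance Definition _ p := GRing.isLinear.Build R 'rV[R]_n R _ (pairing p)
  (pairing_is_linear p).

Lemma pairing_delta p i : pairing p (delta_mx 0 i) = p 0 i.
Proof.
rewrite pairingE (bigD1 i)//= big1 ?addr0 ?mxE ?eqxx ?mulr1// => j ji.
by rewrite mxE (negPf ji) mulr0.
Qed.

Lemma pairing_mul p u (A B : 'M[R]_n) :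
  pairing (p *m A) (u *m B) = pairing (p *m (A *m B^T)) u.
Proof. by rewrite /pairing trmx_mul !mulmxA. Qed.

Lemma differentiable_pairing p u : differentiable (pairing p) u.
Proof.
rewrite (_ : pairing p = \sum_i (p 0 i *: (fun u : 'rV[R]_n => u 0 i))); last first.
  by apply/funext => v; rewrite pairingE fct_sumE.
apply: differentiable_sum => i; apply: differentiableZ; exact: differentiable_coord.
Qed.

Lemma continuous_pairing p : continuous (pairing p).
Proof. by move=> u; exact/differentiable_continuous/differentiable_pairing. Qed.

Lemma derive_pairing p u v : 'D_u (pairing p) v = pairing p u.
Proof.
by rewrite deriveE ?diff_lin//; [exact: continuous_pairing|exact: differentiable_pairing].
Qed.

End pairing.

Section sphere.
Context {R : realType} {n : nat}.

(** The norm of row vectors is the sup norm, so this is the boundary of a cube: a compact set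
    meeting every ray. *)
Definition sphere : set 'rV[R]_n := [set v | `|v| = 1].

Lemma compact_sphere : compact sphere.
Proof.
apply: bounded_closed_compact.
  by exists 1; split => // x x1 v /= ->; rewrite ltW.
have -> : sphere = (fun v : 'rV[R]_n => `|v|) @^-1` [set 1] by [].
by apply: closed_comp => [v _|]; [exact: norm_continuous|exact: closed_eq].
Qed.

Lemma sphere_neq0 v : sphere v -> v != 0.
Proof. by move=> v1; rewrite -normr_gt0 v1. Qed.

Lemma normalize_sphere (v : 'rV[R]_n) : v != 0 -> sphere (`|v|^-1 *: v).
Proof.
move=> v0; rewrite /sphere/= normrZ ger0_norm ?invr_ge0// mulVf//.
by rewrite normr_eq0.
Qed.

End sphere.

Section dual_norm.
Context {R : realType} {m : nat}.
Variable f : 'rV[R]_m.+1 -> R.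
Hypothesis f_homog : forall (l : R) (v : 'rV[R]_m.+1), 0 < l -> f (l *: v) = l * f v.
Hypothesis f_ge0 : forall v, 0 <= f v.
Hypothesis f_eq0 : forall v, f v = 0 <-> v = 0.

(** [c] is the dual norm of [p], the maximum of [pairing p v / f v] over the compact sphere;
    homogeneity extends the bound to all vectors. *)
Lemma dual_norm_attained p : continuous f -> p != 0 ->
  exists v c, [/\ v != 0, 0 < c, pairing p v = c * f v &
    forall w, pairing p w <= c * f w].
Proof.
move=> cf p0; have f_gt0 := norm_gt0 f_ge0 f_eq0.
have p'0 := normalize_sphere p0.
pose h v := pairing p v / f v.
have ch : {within sphere, continuous h}.
  apply: continuous_in_subspaceT => v /set_mem /sphere_neq0 v0.
  apply: continuousM; first exact: continuous_pairing.
  by apply: continuousV; [rewrite gt_eqF ?f_gt0 | exact: cf].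
have [|v /set_mem v1 vmax] := EVT_max_rV _ (compact_sphere) ch.
  by exists (`|p|^-1 *: p).
have v0 := sphere_neq0 v1; exists v, (h v); split => //.
(* The maximum is positive because [p] itself is a test vector, and its pairing with itself is a
   nonzero sum of squares. *)
- have : h (`|p|^-1 *: p) <= h v by apply: vmax; exact/mem_set.
  apply: lt_le_trans; rewrite /h linearZ/= f_homog ?invr_gt0 ?normr_gt0//.
  rewrite divr_gt0// ?mulr_gt0 ?invr_gt0 ?normr_gt0 ?f_gt0//.
  rewrite pairingE; have [i pi0] : exists i, p 0 i != 0 by apply/rV0Pn.
  rewrite (bigD1 i)//= ltr_pwDl// ?sumr_ge0//; last first.
    by move=> j _; rewrite -expr2 sqr_ge0.
  by rewrite -expr2 exprn_even_gt0//= pi0 .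
- by rewrite divfK// gt_eqF ?f_gt0.
- move=> w; have [->|w0] := eqVneq w 0.
    by rewrite linear0 (_ : f 0 = 0) ?mulr0//; exact/f_eq0.
  rewrite -ler_pdivrMr ?f_gt0//.
  have := vmax (`|w|^-1 *: w) (mem_set (normalize_sphere w0)).
  rewrite {1}/h linearZ/= f_homog ?invr_gt0 ?normr_gt0//.
  by rewrite -mulf_div divff ?mul1r// invr_eq0 normr_eq0.
Qed.

(** The function p - c f is nonpositive and vanishes at [v], so its derivative there is nonpositive
    in every direction, hence zero by linearity. *)
Lemma pairing_eq_derive p c v : differentiable f v ->
  pairing p v = c * f v -> (forall w, pairing p w <= c * f w) ->
  forall u, pairing p u = c * 'D_u f v.
Proof.
move=> df pv ple.
pose h : 'rV[R]_m.+1 -> R := pairing p - c *: f.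
have dh : differentiable h v.
  apply: differentiableB; first exact: differentiable_pairing.
  exact: differentiableZ.
have hle u : 'D_u h v <= 0.
  apply: derive_le0_of_le => // k.
  have -> : h v = 0 by rewrite /h !fctE pv subrr.
  by rewrite /h !fctE subr_le0.
have hE u : 'D_u h v = pairing p u - c * 'D_u f v.
  rewrite deriveB; [|exact/diff_derivable/differentiable_pairing|].
    by rewrite derive_pairing deriveZ//; exact: diff_derivable.
  exact/derivableZ/diff_derivable.
move=> u; apply/eqP; rewrite -subr_eq0 -hE eq_le hle/=.
by have := hle (- u); rewrite !deriveE// linearN oppr_le0.
Qed.

End dual_norm.

(** * Alternating forms and wedge products *)

Section block_perm.

(** By injectivity, a permutation that preserves the right block preserves the left one too; its
    sign is read off the determinant of a block diagonal permutation matrix. *)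
Lemma block_perm k l (s : 'S_(k + l)) :
  (forall j, exists j', s (rshift k j) = rshift k j') ->
  exists s1 : 'S_k, exists s2 : 'S_l,
    [/\ forall i, s (lshift l i) = lshift l (s1 i),
        forall j, s (rshift k j) = rshift k (s2 j) & s = (s1 (+) s2) :> bool].
Proof.
move=> /choice[g sg].
have ginj : injective g.
  by move=> i j gij; apply: (@rshift_inj k); apply: (@perm_inj _ s); rewrite !sg gij.
have sl i : exists i', s (lshift l i) = lshift l i'.
  case: (split_ordP (s (lshift l i))) => [i' ->|j' sij]; first by exists i'.
  have [h hg gh] := injF_bij ginj.
  have : s (lshift l i) = s (rshift k (h j')) by rewrite sg gh.
  by move/perm_inj/eqP; rewrite eq_lrshift.
case/choice: sl => f sf.
have finj : injective f.
  by move=> i j fij; apply: (@lshift_inj k l); apply: (@perm_inj _ s); rewrite !sf fij.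
exists (perm finj), (perm ginj); split.
- by move=> i; rewrite permE.
- by move=> i; rewrite permE.
have : \det (perm_mx s : 'M[int]_(k + l)) =
    \det (block_mx (perm_mx (perm finj)) 0 0 (perm_mx (perm ginj))).
  congr (\det _); apply/matrixP => i j; rewrite !mxE.
  case: (split_ordP i) => i' ->; rewrite mxE; case: (split_ordP j) => j' ->;
    rewrite !mxE ?permE ?sf ?sg ?eq_lrshift ?eq_rlshift//.
  by rewrite (inj_eq (@rshift_inj _ _)).
rewrite det_ublock !det_perm -signr_addb => /eqP.
by rewrite (inj_eq signr_inj) => /eqP.
Qed.

End block_perm.

Section forms.
Context {R : realType} {E : normedModType R}.

Lemma multilinear0 k (a : kform R E k) (w : 'I_k -> E) i :
  multilinear a -> w i = 0 -> a w = 0.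
Proof.
move=> alin wi0; have := alin w i 1 0 0.
rewrite scaler0 addr0 mul1r.
have -> : ([eta w with i |-> 0] : 'I_k -> E) = w.
  by apply/funext => j /=; case: eqP => // ->.
by move=> /eqP; rewrite -subr_eq0 opprD addNKr oppr_eq0 => /eqP.
Qed.

Lemma multilinearD k (a : kform R E k) (w : 'I_k -> E) i u v :
  multilinear a ->
  a [eta w with i |-> u + v] = a [eta w with i |-> u] + a [eta w with i |-> v].
Proof. by move=> alin; have := alin w i 1 u v; rewrite scale1r mul1r. Qed.

(** Polarization: with [w i + w j] in both positions i and j the form vanishes, and expanding leaves
    the two mixed terms. *)
Lemma alternate_tperm k (a : kform R E k) (w : 'I_k -> E) i j :
  multilinear a -> alternate a -> i != j -> a (w \o tperm i j) = - a w.
Proof.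
move=> alin aalt ij.
have ji : j != i by rewrite eq_sym.
pose W (u v : E) (k : 'I_k) := if k == i then u else if k == j then v else w k.
have WD1 u v x : a (W (u + v) x) = a (W u x) + a (W v x).
  have WE y : W y x = [eta W 0 x with i |-> y].
    by apply/funext => l; rewrite /W/=; case: eqP.
  by rewrite (WE (u + v)) (WE u) (WE v) multilinearD.
have WD2 u v x : a (W x (u + v)) = a (W x u) + a (W x v).
  have WE y : W x y = [eta W x 0 with j |-> y].
    by apply/funext => l; rewrite /W/=; case: (l =P j) => [->|]; rewrite ?(negPf ji).
  by rewrite (WE (u + v)) (WE u) (WE v) multilinearD.
have W0 u : a (W u u) = 0.
  by apply: (aalt _ i j) => //; rewrite /W !eqxx (negPf ji).
have -> : w \o tperm i j = W (w j) (w i).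
  apply/funext => l; rewrite /W/=; case: tpermP => [->|->|/eqP li /eqP lj].
  - by rewrite eqxx.
  - by rewrite (negPf ji) eqxx.
  - by rewrite (negPf li) (negPf lj).
have -> : a w = a (W (w i) (w j)).
  congr a; apply/funext => l; rewrite /W.
  by case: (l =P i) => [->|_]//; case: (l =P j) => [->|].
have := W0 (w i + w j); rewrite WD1 !WD2 !W0 add0r addr0 => /eqP.
by rewrite addrC addr_eq0 => /eqP.
Qed.

Lemma alternate_perm k (a : kform R E k) (w : 'I_k -> E) (s : 'S_k) :
  multilinear a -> alternate a -> a (w \o s) = (-1) ^+ s * a w.
Proof.
move=> alin aalt; case: (prod_tpermP s) => ts -> {s}.
elim: ts w => [w _|[i j] ts IH w /= /andP[ij dts]].
  rewrite big_nil odd_perm1 expr0 mul1r; congr a; apply/funext => i /=.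
  by rewrite perm1.
rewrite big_cons/= odd_permM odd_tperm ij signr_addb expr1 mulN1r mulNr -IH//.
rewrite -(alternate_tperm _ alin aalt ij); congr a; apply/funext => x /=.
by rewrite permM.
Qed.

Section wedge_block.
Variables (k l : nat) (a a' : kform R E k) (b : kform R E l) (w : 'I_(k + l) -> E).

Hypothesis b0 : forall (h : 'I_l -> 'I_(k + l)) i j,
  h i = lshift l j -> b (w \o h) = 0.

Lemma wedge_block_perm (s : 'S_(k + l)) : b (fun j => w (s (rshift k j))) != 0 ->
  exists s1 : 'S_k, exists s2 : 'S_l,
    [/\ forall i, s (lshift l i) = lshift l (s1 i),
        forall j, s (rshift k j) = rshift k (s2 j) & s = (s1 (+) s2) :> bool].
Proof.
move=> bs; apply: block_perm => j.
case: (split_ordP (s (rshift k j))) => [i' sj|j' ->]; last by exists j'.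
by move: bs; rewrite [b _](b0 (h := s \o @rshift k l) sj) eqxx.
Qed.

(** In a nonzero term [b] takes no vector of the left block, so [a] receives exactly these vectors,
    permuted. *)
Lemma eq_wedge_block :
  (forall h : 'I_k -> 'I_k, a (w \o @lshift k l \o h) = a' (w \o @lshift k l \o h)) ->
  wedge a b w = wedge a' b w.
Proof.
move=> aa'; rewrite /wedge; congr (_ * _); apply: eq_bigr => s _.
have [b_eq0|b_neq0] := eqVneq (b (fun j => w (s (rshift k j)))) 0.
  by rewrite b_eq0 !mulr0.
have [s1 [_ [sl _ _]]] := wedge_block_perm b_neq0.
congr (_ * _ * _); have := aa' s1; congr (_ = _); congr (_ _);
  by apply/funext => i /=; rewrite sl.
Qed.

(** All nonzero terms of the sum equal [c]: the signs produced by [a] and [b] cancel the sign of the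
    permutation. The identity is among them, so the sum is a positive multiple of [c]. *)
Lemma wedge_block_neq0 : multilinear a -> alternate a -> multilinear b ->
  alternate b -> a (w \o @lshift k l) != 0 -> b (w \o @rshift k l) != 0 ->
  wedge a b w != 0.
Proof.
move=> alin aalt blin balt aw bw; rewrite /wedge mulf_neq0//.
set c := a (w \o @lshift k l) * b (w \o @rshift k l).
pose P (s : 'S_(k + l)) := b (fun j => w (s (rshift k j))) != 0.
rewrite (bigID P)/= [X in _ + X]big1 ?addr0; last first.
  by move=> s /negPn/eqP ->; rewrite mulr0.
rewrite (eq_bigr (fun=> c)) => [|s /wedge_block_perm[s1 [s2 [sl sr so]]]]; last first.
  have -> : (fun i => w (s (lshift l i))) = (w \o @lshift k l) \o s1.
    by apply/funext => i /=; rewrite sl.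
  have -> : (fun i => w (s (rshift k i))) = (w \o @rshift k l) \o s2.
    by apply/funext => i /=; rewrite sr.
  rewrite !alternate_perm// so signr_addb -/c.
  have sq (e : bool) : (-1) ^+ e * (-1) ^+ e = 1 :> R by rewrite -expr2 sqrr_sign.
  move: (sq s1) (sq s2); set x := (-1) ^+ s1; set y := (-1) ^+ s2 => xx yy.
  by transitivity (x * x * (y * y) * c); [rewrite /c; ring | rewrite xx yy !mul1r].
rewrite sumr_const -mulr_natr mulf_neq0 ?mulf_neq0// pnatr_eq0 -lt0n.
apply/card_gt0P; exists 1%g; rewrite unfold_in /P.
rewrite [X in b X](_ : _ = w \o @rshift k l)//.
by apply/funext => i /=; rewrite perm1.
Qed.

End wedge_block.
End forms.

Section forms_scale.
Context {R : realType} {E : normedModType R}.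
Variable P : E -> Prop.

Let wedge_term_scale (e c d x y : R) : e * (c * x) * (d * y) = c * d * (e * x * y).
Proof. by ring. Qed.

(** [P] stands for the kernel of theta. The comparison of [a] and [a'] is guarded by [0 < k] because
    for m = 0 the form beta has degree 0 and gives no control on the changes of charts. *)
Lemma wedge_pow_scale (a a' : kform R E 2) (c : R) k (w : 'I_(k * 2) -> E) :
  ((0 < k)%N -> forall z, (forall i, P (z i)) -> a z = c * a' z) ->
  (forall i, P (w i)) -> wedge_pow a k w = c ^+ k * wedge_pow a' k w.
Proof.
move=> aa'; elim: k w aa' => [|k IH] w aa' Pw; first by rewrite mulr1.
have {}aa' := aa' isT.
rewrite -[wedge_pow a k.+1]/(wedge a (wedge_pow a k)).
rewrite -[wedge_pow a' k.+1]/(wedge a' (wedge_pow a' k)).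
rewrite /wedge [in RHS]mulrCA; congr (_ * _).
rewrite big_distrr/=; apply: eq_bigr => s _.
rewrite (aa' _ (fun i => Pw _)) (IH _ (fun=> aa') (fun i => Pw _)) exprS.
exact: wedge_term_scale.
Qed.

(** If [a] receives the vector of index [i0], then [b] receives only vectors in [P] and scales by
    [d]; otherwise [a'] vanishes and so does the term. *)
Lemma wedge_scale l (a a' : kform R E 1) (b b' : kform R E l) (c d : R)
    (w : 'I_(1 + l) -> E) i0 :
  (forall z, a z = c * a' z) -> (forall z, P (z ord0) -> a' z = 0) ->
  (forall z, (forall i, P (z i)) -> b z = d * b' z) ->
  (forall i, i != i0 -> P (w i)) ->
  wedge a b w = c * d * wedge a' b' w.
Proof.
move=> aa' a'0 bb' Pw; rewrite /wedge [in RHS]mulrCA; congr (_ * _).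
rewrite big_distrr/=; apply: eq_bigr => s _; rewrite aa'.
have [si0|si0] := eqVneq (s (lshift l ord0)) i0.
  rewrite bb'; first exact: wedge_term_scale.
  move=> j; apply: Pw; rewrite -si0 (inj_eq perm_inj).
  by rewrite eq_rlshift.
by rewrite a'0; [rewrite !(mulr0, mul0r) | exact: Pw].
Qed.

End forms_scale.

(** [U k] is the family with only its first k vectors sheared; passing from k to k + 1 adds a term
    in which [e i0] occurs twice. *)
Lemma alternate_shear {R : realType} {E : normedModType R} n (a : kform R E n) (e : 'I_n -> E) i0 (c : 'I_n -> R) :
  multilinear a -> alternate a ->
  a (fun j => if j == i0 then e i0 else e j - c j *: e i0) = a e.
Proof.
move=> alin aalt.
pose U k (j : 'I_n) := if (j < k)%N && (j != i0) then e j - c j *: e i0 else e j.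
have -> : (fun j => if j == i0 then e i0 else e j - c j *: e i0) = U n.
  by apply/funext => j; rewrite /U ltn_ord/=; case: eqP => // ->.
suff H k : (k <= n)%N -> a (U k) = a e by apply: H.
elim: k => [_|k IH kn]; first by congr a.
rewrite -(IH (ltnW kn)); pose j0 := Ordinal kn.
have [j0i|j0i] := eqVneq j0 i0.
  congr a; apply/funext => j; rewrite /U ltnS leq_eqVlt.
  have [jk|//] := eqVneq (j : nat) k.
  have -> : j = i0 by rewrite -j0i; apply: val_inj.
  by rewrite eqxx !andbF.
have -> : U k.+1 = [eta U k with j0 |-> (- c j0) *: e i0 + e j0].
  apply/funext => j /=; rewrite /U ltnS leq_eqVlt; have [->|jj] := eqVneq j j0.
    by rewrite eqxx/= j0i scaleNr addrC.
  by rewrite -[(j == k :> nat)]/(j == j0) (negPf jj).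
rewrite alin [X in _ * X + _](_ : _ = 0) ?mulr0 ?add0r.
  congr a; apply/funext => j /=; case: eqP => // ->.
  by rewrite /U ltnn.
apply: (aalt _ j0 i0) => //=; rewrite eqxx eq_sym (negPf j0i).
by rewrite /U eqxx andbF.
Qed.

(** * Rays and charts *)

Section ray_theory.
Context {R : realType} {m : nat}.
Implicit Types (r : ray R m) (v : 'rV[R]_m.+1).

Lemma ray_repr_neq0 r : ray_repr r != 0.
Proof. exact: valP (repr r). Qed.

Lemma ray_ofZ (l : R) v : 0 < l -> v != 0 -> ray_of (l *: v) = ray_of v.
Proof.
move=> l0 v0; have lv0 : l *: v != 0 by rewrite scaler_eq0 negb_or gt_eqF.
rewrite /ray_of; apply/eqP; rewrite eqmodE/=; apply/asboolP.
by exists l^-1; rewrite ?invr_gt0// !insubdK// scalerA mulVf ?scale1r// gt_eqF.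
Qed.

Lemma ray_reprK r : ray_of (ray_repr r) = r.
Proof. by rewrite /ray_of /ray_repr valKd reprK. Qed.

Lemma ray_repr_of v : v != 0 -> exists2 l : R, 0 < l & ray_repr (ray_of v) = l *: v.
Proof.
move=> v0; have : ray_of (ray_repr (ray_of v)) = ray_of v by exact: ray_reprK.
rewrite /ray_of => /eqP; rewrite eqmodE/= => /ray_rel_imp/asboolP.
by rewrite !insubdK ?unfold_in ?ray_repr_neq0// => -[l l0 ->]; exists l.
Qed.

Lemma pivot_neq0 v : v != 0 -> v 0 (pivot v) != 0.
Proof.
move=> v0; apply/eqP => p0; move/eqP: v0; apply; apply/rowP => i; rewrite mxE.
apply/eqP; rewrite -normr_le0; move: p0; rewrite /pivot.
case: arg_maxP => // j _ jmax vj0; have := jmax i isT.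
by rewrite vj0 normr0.
Qed.

Lemma affine_vec_pivot i (s : R) (t : 'rV[R]_m) : affine_vec i s t 0 i = s.
Proof. by rewrite mxE unlift_none. Qed.

Lemma col'_affine_vec i (s : R) (t : 'rV[R]_m) : col' i (affine_vec i s t) = t.
Proof. by apply/rowP => j; rewrite !mxE liftK. Qed.

Lemma affine_vec_col' i v : affine_vec i (v 0 i) (col' i v) = v.
Proof.
apply/rowP => j; rewrite mxE; case: unliftP => [k ->|->//].
by rewrite mxE.
Qed.

Lemma affine_vecZ i (c s : R) (t : 'rV[R]_m) :
  affine_vec i (c * s) (c *: t) = c *: affine_vec i s t.
Proof. by apply/rowP => j; rewrite !mxE; case: unliftP => [k _|_]; rewrite ?mxE. Qed.

Lemma affine_vec_neq0 i (s : R) (t : 'rV[R]_m) : s != 0 -> affine_vec i s t != 0.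
Proof.
move=> s0; apply/eqP => /rowP/(_ i); rewrite affine_vec_pivot mxE => /eqP.
by rewrite (negPf s0).
Qed.

End ray_theory.

Section manifold.
Context {R : realType} {m : nat} {M : topologicalType}.
Variable ch : M -> chart M 'rV[R]_m.+1.
Hypothesis hM : oriented_manifold ch.

Definition chart_image (x : M) := to (ch x) @` dom (ch x).

Lemma chart_image_center x : chart_image x (to (ch x) x).
Proof. by exists x => //; exact: om_at hM x. Qed.

Lemma from_center x : from (ch x) (to (ch x) x) = x.
Proof. exact/(om_toK hM)/(om_at hM). Qed.

Lemma fromK x a : chart_image x a -> to (ch x) (from (ch x) a) = a.
Proof. by case=> y xy <-; rewrite (om_toK hM). Qed.

Lemma from_dom x a : chart_image x a -> dom (ch x) (from (ch x) a).
Proof. by case=> y xy <-; rewrite (om_toK hM). Qed.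

Lemma near_chart_image x a : chart_image x a -> \forall b \near a, chart_image x b.
Proof. by move=> xa; apply: open_nbhs_nbhs; split => //; exact: om_im_open hM x. Qed.

Lemma near_from_dom x y z : dom (ch x) z -> dom (ch y) z ->
  \forall a \near to (ch x) z, dom (ch y) (from (ch x) a).
Proof.
move=> xz yz; have xa : chart_image x (to (ch x) z) by exists z.
have cf : {for to (ch x) z, continuous (from (ch x))}.
  have : {within chart_image x, continuous (from (ch x))}.
    exact: (@om_from_cont _ _ _ _ hM x).
  rewrite continuous_open_subspace; last exact: om_im_open hM x.
  by apply; exact/mem_set.
apply: cf; rewrite (om_toK hM)//.
by apply: open_nbhs_nbhs; split => //; exact: om_dom_open hM y.
Qed.

Lemma differentiable_transition x y z : dom (ch x) z -> dom (ch y) z ->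
  differentiable (to (ch y) \o from (ch x)) (to (ch x) z).
Proof. by move=> xz yz; apply: (om_smooth hM (x := x) (y := y) [::]); exists z. Qed.

Lemma diff_jacobian n k (f : 'rV[R]_n -> 'rV[R]_k) a v : 'd f a v = v *m 'J f a.
Proof. by rewrite /jacobian mul_rV_lin1. Qed.

Lemma tan_trans1 x z : dom (ch x) z -> tan_trans ch x x z = 1%:M.
Proof.
move=> xz; apply/row_matrixP => i; rewrite !rowE -diff_jacobian.
rewrite (near_eq_diff (g := id)); first by rewrite diff_val mulmx1.
have xa : chart_image x (to (ch x) z) by exists z.
by apply: filterS (near_chart_image xa) => b; exact: fromK.
Qed.

Lemma tan_trans_mul x y z : dom (ch x) z -> dom (ch y) z ->
  tan_trans ch x y z *m tan_trans ch y x z = 1%:M.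
Proof.
move=> xz yz; apply/row_matrixP => i; rewrite !rowE mulmx1 mulmxA -!diff_jacobian.
have <- : (to (ch y) \o from (ch x)) (to (ch x) z) = to (ch y) z.
  by rewrite /= (om_toK hM).
have dyx : differentiable (to (ch x) \o from (ch y))
    ((to (ch y) \o from (ch x)) (to (ch x) z)).
  by rewrite /= (om_toK hM)//; exact: differentiable_transition.
have dxy := differentiable_transition xz yz.
have := diff_comp dxy dyx => /(congr1 (@^~ (delta_mx 0 i))) /= <-.
rewrite (near_eq_diff (g := id)); first by rewrite diff_val.
have xa : chart_image x (to (ch x) z) by exists z.
apply: filterS2 (near_chart_image xa) (near_from_dom xz yz) => b xb yb /=.
by rewrite (om_toK hM)// fromK.
Qed.

Lemma cotan_trans1 x : cotan_trans ch x x x = 1%:M.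
Proof. by rewrite /cotan_trans tan_trans1 ?trmx1//; exact: om_at hM x. Qed.

Lemma cotan_trans_mul x y : dom (ch x) y ->
  cotan_trans ch x y y *m cotan_trans ch y x y = 1%:M.
Proof.
by move=> xy; rewrite /cotan_trans -trmx_mul tan_trans_mul ?trmx1//; exact: om_at hM y.
Qed.

End manifold.

Section ray_charts.
Context {R : realType} {m : nat} {M : topologicalType}.
Variable ch : M -> chart M 'rV[R]_m.+1.
Hypothesis hM : oriented_manifold ch.
Notation E1 := ('rV[R]_m.+1 * 'rV[R]_m)%type.

Lemma near_chart_image1 x (a : E1) : chart_image ch x a.1 ->
  \forall b \near a, chart_image ch x b.1.
Proof. by case: a => a1 a2 xa; exact: (cvg_fst (near_chart_image hM xa)). Qed.

(** In ray charts, for either choice of fibre coordinates, the bundle projection is the first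
    projection near the centre. *)
Lemma diff_ray_chart_fst tr (p : M * ray R m) (Z : E1) :
  'd (fun a : E1 => to (ch p.1) (from (ray_chart ch tr p) a).1)
    (to (ray_chart ch tr p) p) Z = Z.1.
Proof.
rewrite (near_eq_diff (g := fst)) ?diff_fst//.
apply: filterS (near_chart_image1 (a := to (ray_chart ch tr p) p) _).
  by move=> a; exact: fromK.
exact: chart_image_center.
Qed.

Lemma tangent_HM_proj p Z :
  tangent_map (HM_chart ch) ch (@HM_proj R m M) p Z = Z.1.
Proof. exact: diff_ray_chart_fst. Qed.

Lemma tangent_HsM_proj p Z :
  tangent_map (HsM_chart ch) ch (@HsM_proj R m M) p Z = Z.1.
Proof. exact: diff_ray_chart_fst. Qed.

(** The components in [ch q.1] of the covector, normalized to have pivot component 1 or -1, that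
    spans the ray with coordinates [a]. Pairing it with base components gives the form theta in this
    chart. *)
Definition covector (q : M * ray R m) (a : E1) : 'rV[R]_m.+1 :=
  affine_vec (pivot (ray_repr q.2)) (Num.sg (ray_repr q.2 0 (pivot (ray_repr q.2)))) a.2.

Lemma from_HsM q a : from (HsM_chart ch q) a =
  (from (ch q.1) a.1,
   ray_of (covector q a *m cotan_trans ch q.1 (from (ch q.1) a.1) (from (ch q.1) a.1))).
Proof. by []. Qed.

Lemma covector_neq0 q a : covector q a != 0.
Proof. by apply: affine_vec_neq0; rewrite sgr_eq0 pivot_neq0// ray_repr_neq0. Qed.

Lemma covector_cotan_neq0 q a y : dom (ch q.1) y ->
  covector q a *m cotan_trans ch q.1 y y != 0.
Proof.
move=> qy; apply: contra_neq (covector_neq0 q a).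
move=> /(congr1 (mulmx^~ (cotan_trans ch y q.1 y))).
by rewrite -mulmxA cotan_trans_mul// mulmx1 mul0mx.
Qed.

Lemma covector_center q :
  covector q (to (HsM_chart ch q) q) =
  `|ray_repr q.2 0 (pivot (ray_repr q.2))|^-1 *: ray_repr q.2.
Proof.
rewrite /covector/= cotan_trans1// mulmx1; set p := ray_repr q.2; set i := pivot p.
have pi0 : p 0 i != 0 by rewrite pivot_neq0// ray_repr_neq0.
rewrite -[Num.sg _](_ : `|p 0 i|^-1 * p 0 i = _) ?affine_vecZ ?affine_vec_col'//.
by rewrite {2}[p 0 i]numEsg mulrCA mulVf ?mulr1// normr_eq0.
Qed.

Lemma from_HsM_center q : from (HsM_chart ch q) (to (HsM_chart ch q) q) = q.
Proof.
rewrite from_HsM covector_center /= from_center// cotan_trans1// mulmx1.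
rewrite ray_ofZ ?ray_repr_neq0//; first by rewrite ray_reprK; case: q.
by rewrite invr_gt0 normr_gt0 pivot_neq0// ray_repr_neq0.
Qed.

Lemma HsM_fromK q a : chart_image ch q.1 a.1 ->
  to (HsM_chart ch q) (from (HsM_chart ch q) a) = a.
Proof.
move=> qa; have yx := from_dom hM qa.
have cov0 := covector_cotan_neq0 a yx.
rewrite from_HsM /=; set y := from _ _ in yx cov0 *.
have [l l0 ->] := ray_repr_of cov0.
rewrite -scalemxAl -mulmxA cotan_trans_mul// mulmx1 fromK// linearZ/= scalerA.
rewrite col'_affine_vec mxE affine_vec_pivot normrM (gtr0_norm l0) normr_sg.
rewrite pivot_neq0 ?ray_repr_neq0//= mulr1 mulVf ?scale1r ?gt_eqF//.
by case: a {qa yx cov0 y}.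
Qed.

Lemma HsM_center_image q :
  (to (HsM_chart ch q) @` dom (HsM_chart ch q)) (to (HsM_chart ch q) q).
Proof.
exists q => //; split; first exact: om_at hM q.1.
rewrite /= cotan_trans1// mulmx1 -normrEsg normr_gt0.
by rewrite pivot_neq0// ray_repr_neq0.
Qed.

(** The base component of a change of charts of H^*M is a change of charts of M. Differentiability
    of the whole map is assumed, as its differential would otherwise be 0 by default. *)
Lemma diff_HsM_transition q a (w : E1) : chart_image ch q.1 a.1 ->
  let q' := from (HsM_chart ch q) a in
  differentiable (to (HsM_chart ch q') \o from (HsM_chart ch q)) a ->
  ('d (to (HsM_chart ch q') \o from (HsM_chart ch q)) a w).1 =
  w.1 *m tan_trans ch q.1 q'.1 q'.1.
Proof.
move=> qa q' dt; rewrite diff_comp_fst//.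
have yx : dom (ch q.1) q'.1 by exact: from_dom.
rewrite (_ : fst \o _ = (to (ch q'.1) \o from (ch q.1)) \o fst)//.
have dyx : differentiable (to (ch q'.1) \o from (ch q.1)) a.1.
  by rewrite -(fromK hM qa); apply: differentiable_transition => //; exact: om_at hM q'.1.
rewrite (diff_comp (differentiable_fst a) dyx)/= diff_fst diff_jacobian.
by rewrite /tan_trans fromK.
Qed.

Lemma pairing_cotan_tan x y (p v : 'rV[R]_m.+1) : dom (ch x) y ->
  pairing (p *m cotan_trans ch x y y) (v *m tan_trans ch x y y) = pairing p v.
Proof.
move=> xy; rewrite pairing_mul /cotan_trans -trmx_mul tan_trans_mul//.
  by rewrite trmx1 mulmx1.
exact: om_at hM y.
Qed.

End ray_charts.

(** * The Legendre transform of a Finsler metric *)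

Section fibre_norm.
Context {R : realType} {m : nat} {M : topologicalType}.
Variable ch : M -> chart M 'rV[R]_m.+1.
Hypothesis hM : oriented_manifold ch.
Variable F : M -> 'rV[R]_m.+1 -> R.
Hypothesis hF : finsler ch F.
Notation E1 := ('rV[R]_m.+1 * 'rV[R]_m)%type.

Lemma TM_local_center x v : TM_local ch F x (to (ch x) x, v) = F x v.
Proof.
rewrite /TM_local/= from_center// tan_trans1 ?mulmx1//; exact: om_at hM x.
Qed.

Lemma finsler_continuous x : continuous (F x).
Proof.
move=> v.
have cT := finsler_cont hF (a := (to (ch x) x, v)) (chart_image_center hM x).
rewrite (_ : F x = TM_local ch F x \o (fun v => (to (ch x) x, v))); last first.
  by apply/funext => w /=; rewrite TM_local_center.
apply: continuous_comp; last exact: cT.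
by apply: differentiable_continuous; exact: differentiable_pair.
Qed.

Lemma differentiable_fibre (g : 'rV[R]_m.+1 * 'rV[R]_m.+1 -> R) (a v : 'rV[R]_m.+1) :
  differentiable g (a, v) -> differentiable (fun w => g (a, w)) v.
Proof.
by move=> dg; apply: (@differentiable_comp _ _ _ _ (fun w => (a, w)) g).
Qed.

Lemma finsler_differentiable x v : v != 0 -> differentiable (F x) v.
Proof.
move=> v0; have := @finsler_smooth _ _ _ _ _ hF x [::] (to (ch x) x, v).
move=> /(_ (conj (chart_image_center hM x) v0)) /differentiable_fibre.
rewrite (_ : (fun w => _) = F x)//.
by apply/funext => w /=; rewrite TM_local_center.
Qed.

(** ['D_u (F x)] is the restriction to the fibre of the derivative of [TM_local] in the direction
    (0, u). *)
Lemma finsler_differentiable2 x u v : v != 0 -> differentiable ('D_u (F x)) v.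
Proof.
move=> v0; have := @finsler_smooth _ _ _ _ _ hF x [:: (0, u)] (to (ch x) x, v).
move=> /(_ (conj (chart_image_center hM x) v0)) /differentiable_fibre.
rewrite (_ : (fun w => _) = 'D_u (F x))//.
apply/funext => w /=; rewrite /derive.
rewrite (_ : (fun h => _) =
  (fun h => h^-1 *: ((F x \o shift w) (h *: u) - F x w)))//.
apply/funext => h /=; rewrite TM_local_center.
rewrite -[_ + (to (ch x) x, w)]/(h *: 0 + to (ch x) x, h *: u + w).
by rewrite scaler0 add0r TM_local_center.
Qed.

Lemma finsler_derive_euler x v : v != 0 -> 'D_v (F x) v = F x v.
Proof. by apply: derive_euler => // l w; exact: finsler_homog hF x l w. Qed.

Lemma finsler_derive_le x v u : v != 0 -> 'D_u (F x) v <= F x u.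
Proof.
apply: derive_norm_le.
- by move=> l w; exact: finsler_homog hF x l w.
- exact: finsler_ge0 hF x.
- exact: finsler_eq0 hF x.
- exact: finsler_differentiable.
- exact: finsler_differentiable2.
- exact: finsler_convex hF x.
Qed.

Lemma finsler_gt0 x v : v != 0 -> 0 < F x v.
Proof. exact: norm_gt0 (finsler_ge0 hF x) (finsler_eq0 hF x) v. Qed.

Definition gradient (p : M * ray R m) : 'rV[R]_m.+1 :=
  \row_i 'D_(delta_mx 0 i) (F p.1) (ray_repr p.2).

Lemma gradientE (p : M * ray R m) u :
  'D_u (F p.1) (ray_repr p.2) = pairing (gradient p) u.
Proof.
have dF := finsler_differentiable p.1 (ray_repr_neq0 p.2).
rewrite deriveE// pairingE {1}(row_sum_delta u) linear_sum; apply: eq_bigr => i _.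
by rewrite linearZ mxE deriveE// mulrC.
Qed.

Lemma gradient_neq0 p : gradient p != 0.
Proof.
apply/eqP => g0; have v0 := ray_repr_neq0 p.2.
have := finsler_gt0 p.1 v0; rewrite -finsler_derive_euler// gradientE g0.
by rewrite /pairing mul0mx mxE ltxx.
Qed.

Lemma hilbertE p Z : hilbert ch F p Z = 'D_(Z ord0).1 (F p.1) (ray_repr p.2).
Proof. by rewrite /hilbert tangent_HM_proj. Qed.

(** The Hilbert form sees only base components, so any lift gives the same value;
    [(delta_mx 0 i, 0)] shows that a lift exists. *)
Lemma legendreE p : legendre ch F p = (p.1, ray_of (gradient p)).
Proof.
rewrite /legendre; congr (_, ray_of _); apply/rowP => i; rewrite !mxE hilbertE.
case: xgetP => [Z _ /=|N]; first by rewrite tangent_HM_proj// => ->.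
by exfalso; apply: (N (delta_mx 0 i, 0)); rewrite /= tangent_HM_proj.
Qed.

(** A preimage is the ray of a vector at which the dual norm of the covector is attained: there the
    covector is a positive multiple of the differential of F. *)
Lemma legendre_surj q : exists p, legendre ch F p = q.
Proof.
have r0 := ray_repr_neq0 q.2.
have [v [c [v0 c0 rv rle]]] := dual_norm_attained
  (fun l w => @finsler_homog _ _ _ _ _ hF q.1 l w) (finsler_ge0 hF q.1)
  (finsler_eq0 hF q.1) (@finsler_continuous q.1) r0.
exists (q.1, ray_of v); rewrite legendreE [RHS]surjective_pairing; congr (_, _).
rewrite -[RHS]ray_reprK -(ray_ofZ c0); last exact: gradient_neq0.
congr ray_of; apply/rowP => i; rewrite -[RHS]pairing_delta.
have [l l0 lE] := ray_repr_of v0.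
rewrite (@pairing_eq_derive _ _ (F q.1) (ray_repr q.2) c (l *: v)) ?mxE/= ?lE//.
- by apply: finsler_differentiable; rewrite scaler_eq0 negb_or gt_eqF.
- by rewrite linearZ/= rv (finsler_homog hF)// mulrCA.
Qed.

Lemma legendre_invK q : legendre ch F (legendre_inv ch F q) = q.
Proof. exact: (xgetPex q (legendre_surj q)). Qed.

Lemma legendre_inv1 q : (legendre_inv ch F q).1 = q.1.
Proof. by have := legendre_invK q; rewrite legendreE => /(congr1 fst). Qed.

(** The differential of F at the Legendre preimage spans the ray [q]; the factor [c] is the inverse
    of the dual norm of [ray_repr q.2]. *)
Lemma derive_legendre_inv q : exists2 c : R, 0 < c &
  forall u, 'D_u (F q.1) (ray_repr (legendre_inv ch F q).2) =
    c * pairing (ray_repr q.2) u.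
Proof.
have := legendre_invK q; rewrite legendreE => /(congr1 (ray_repr \o snd))/=.
have [l l0 ->] := ray_repr_of (gradient_neq0 (legendre_inv ch F q)) => lE.
exists l^-1; first by rewrite invr_gt0.
move=> u; rewrite -lE pairingZl mulrA mulVf ?gt_eqF// mul1r -gradientE.
by rewrite legendre_inv1.
Qed.

(* The junk value of the differential is 0, so the contact form vanishes where
   the inverse Legendre transform fails to be differentiable. *)
Lemma contact_formE q :
  (forall Z, contact_form ch F q Z = 0) \/
  (forall Z, contact_form ch F q Z =
     'D_(Z ord0).1 (F q.1) (ray_repr (legendre_inv ch F q).2)).
Proof.
rewrite /contact_form /pullback /tangent_map.
set L := _ \o from (HsM_chart ch q); set a := to (HsM_chart ch q) q.
have [dL|NL] := pselect (differentiable L a); [right|left] => Z; last first.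
  by rewrite hilbertE diff_eq0//= derive0.
rewrite hilbertE legendre_inv1; congr ('D_ _ _ _).
(* The inverse Legendre transform preserves base points, so the base component of [L] is that of the
   chart of H^*M. *)
rewrite diff_comp_fst// -[RHS](diff_ray_chart_fst hM (cotan_trans ch) q).
rewrite (_ : fst \o L = fun a => to (ch q.1) (from (HsM_chart ch q) a).1)//.
by apply/funext => b; rewrite /L /= !legendre_inv1.
Qed.

End fibre_norm.

(** * Analytic tools for a merely continuous coefficient *)

Section derive_mul.
Context {R : realType} {V : normedModType R}.

(** As [h a = 0], the difference quotient of the product is that of [h] times the value of [g] at
    the moving point. This gives dB = g dtheta on the kernel of theta with g known only to be
    continuous. *)
Lemma derive_mul_eq0 (g h : V -> R) (a u : V) : {for a, continuous g} ->
  derivable h a u -> h a = 0 ->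
  'D_u (fun b => g b * h b) a = g a * 'D_u h a.
Proof.
move=> cg dh ha0; apply/cvg_lim => //.
rewrite (_ : (fun t => _) = (fun t => g (t *: u + a) *
  (t^-1 *: ((h \o shift a) (t *: u) - h a)))); last first.
  apply/funext => t /=; rewrite ha0 mulr0 !subr0.
  by rewrite -[LHS]/(_ * (_ * _)) mulrCA.
apply: cvgM; last exact: dh.
apply: cvg_comp; last exact: cg.
have : (fun t : R => t *: u + a) @ 0 --> 0 *: u + a.
  by apply: cvgD; [apply: cvgZr_tmp; exact: cvg_id | exact: cvg_cst].
by rewrite scale0r add0r; apply: cvg_within_filter.
Qed.

End derive_mul.

Section coefficient.
Context {R : realType} {n : nat} {T : topologicalType}.
Variables (N P : 'rV[R]_n -> T -> R) (g : T -> R) (a0 : T).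
Hypothesis cN : forall w, sphere w -> {for (w, a0), continuous (fun z => N z.1 z.2)}.
Hypothesis cP : forall w, sphere w -> {for (w, a0), continuous (fun z => P z.1 z.2)}.
Hypothesis N_gt0 : \forall a \near a0, forall w, sphere w -> 0 < N w a.
Hypothesis g_gt0 : \forall a \near a0, 0 < g a.
Hypothesis gP_le : \forall a \near a0, forall w, sphere w -> g a * P w a <= N w a.
Hypothesis gP_eq : \forall a \near a0, exists2 w, sphere w & g a * P w a = N w a.

(* The coefficient g is the minimum over the sphere of the quotients N / P with
   P positive. *)
Lemma continuous_min_ratio : {for a0, continuous g}.
Proof.
have P_gt0 a w : 0 < g a -> 0 < N w a -> g a * P w a = N w a -> 0 < P w a.
  by move=> ga Nwa E; rewrite -(pmulr_rgt0 _ ga) E.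
have g0 := nbhs_singleton g_gt0; have N0 := nbhs_singleton N_gt0.
have [w0 w01 w0E] := nbhs_singleton gP_eq.
have cN0 : {for a0, continuous (N w0)}.
  apply: (continuous_comp (f := fun a => (w0, a)) (g := fun z => N z.1 z.2)).
    by apply: (@cvg_pair _ _ _ _ (nbhs w0) (nbhs a0)); [exact: cvg_cst | exact: cvg_id].
  exact: cN.
have cP0 : {for a0, continuous (P w0)}.
  apply: (continuous_comp (f := fun a => (w0, a)) (g := fun z => P z.1 z.2)).
    by apply: (@cvg_pair _ _ _ _ (nbhs w0) (nbhs a0)); [exact: cvg_cst | exact: cvg_id].
  exact: cP.
have Pw0 := P_gt0 _ _ g0 (N0 _ w01) w0E.
apply/cvgrPdist_lt => e e0.
(* Upper bound: the minimizer [w0] at [a0] is a test vector at nearby points. *)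
have upper : \forall a \near a0, 0 < (g a0 + e) * P w0 a - N w0 a.
  apply: (cvgr_gt ((g a0 + e) * P w0 a0 - N w0 a0)).
    by apply: cvgB => //; apply: cvgMl_tmp.
  by rewrite -w0E -mulrBl addrC addKr mulr_gt0.
have Pw0a : \forall a \near a0, 0 < P w0 a by exact: (cvgr_gt (P w0 a0)).
(* This is g(a0) - e truncated at 0: nonnegativity of [k] handles the vectors where P is
   nonpositive. *)
pose k := g a0 - Num.min e (g a0).
have k0 : 0 <= k by rewrite subr_ge0 ge_min lexx orbT.
have kg : k < g a0 by rewrite ltrBlDr ltrDl lt_min e0.
(* Lower bound: compactness makes the strict inequality uniform over the sphere, so it applies to
   the minimizer at [a], which moves with [a]. *)
have lower : \forall a \near a0, sphere `<=` [set w | 0 < N w a - k * P w a].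
  apply: (@iffLR _ _ (compact_near_coveringP _) compact_sphere) => w w1.
  have c : (fun z : 'rV[R]_n * T => N z.1 z.2 - k * P z.1 z.2) @ (w, a0)
      --> N w a0 - k * P w a0.
    by apply: cvgB; [exact: cN | apply: cvgMl_tmp; exact: cP].
  apply: (cvgr_gt _ c).
  rewrite subr_gt0; have [Pw|Pw] := ltP 0 (P w a0).
    apply: lt_le_trans (nbhs_singleton gP_le w w1).
    by rewrite ltr_pM2r.
  by apply: le_lt_trans (N0 w w1); rewrite mulr_ge0_le0.
near=> a.
have ga : 0 < g a by near: a.
rewrite ltr_distlC; apply/andP; split.
  have [w w1 wE] : exists2 w, sphere w & g a * P w a = N w a by near: a.
  have Nw : forall w, sphere w -> 0 < N w a by near: a.
  have Pw := P_gt0 _ _ ga (Nw w w1) wE.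
  have low : sphere `<=` [set w | 0 < N w a - k * P w a] by near: a.
  have := low w w1; rewrite /= -wE -mulrBl pmulr_lgt0// subr_gt0.
  by apply: le_lt_trans; rewrite lerB// ge_min lexx.
have gle : forall w, sphere w -> g a * P w a <= N w a by near: a.
have Pw : 0 < P w0 a by near: a.
have up : 0 < (g a0 + e) * P w0 a - N w0 a by near: a.
rewrite -(ltr_pM2r Pw); apply: le_lt_trans (gle w0 w01) _.
by rewrite -subr_gt0.
Unshelve. all: by end_near. Qed.

End coefficient.

(** * The contact form in a chart *)

Section contact_coefficient.
Context {R : realType} {m : nat} {M : topologicalType}.
Variable ch : M -> chart M 'rV[R]_m.+1.
Hypothesis hM : oriented_manifold ch.
Variable F : M -> 'rV[R]_m.+1 -> R.
Hypothesis hF : finsler ch F.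
Notation E1 := ('rV[R]_m.+1 * 'rV[R]_m)%type.
Variable q : M * ray R m.
Notation a0 := (to (HsM_chart ch q) q).
Notation from_q := (from (HsM_chart ch q)).

Definition legendre_vec (q' : M * ray R m) := ray_repr (legendre_inv ch F q').2.

(** States that B = g theta at the point with coordinates [a]: the vector [w] is carried from
    [ch q.1] to the chart [ch y], in which the components at y are taken. *)
Definition legendre_coef (a : E1) (g : R) := let y := from (ch q.1) a.1 in
  0 < g /\ forall w,
    'D_(w *m tan_trans ch q.1 y y) (F y) (legendre_vec (from_q a)) =
    g * pairing (covector q a) w.

Lemma exists_legendre_coef : exists g : E1 -> R,
  forall a, chart_image ch q.1 a.1 -> legendre_coef a (g a).
Proof.
suff /choice : forall a : E1, exists g : R, chart_image ch q.1 a.1 -> legendre_coef a g.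
  by move=> [g hg]; exists g.
move=> a; have [qa|Nqa] := pselect (chart_image ch q.1 a.1); last by exists 0.
set y := from (ch q.1) a.1.
have xy : dom (ch q.1) y by exact: from_dom.
have [c c0 cE] := derive_legendre_inv hM hF (from_q a).
have [l l0 lE] := ray_repr_of (covector_cotan_neq0 hM a xy).
(* [c] comes from the Legendre transform, [l] from comparing the chosen representative of the ray
   with the transported normalized covector. *)
exists (c * l) => _; split; first exact: mulr_gt0.
move=> w; rewrite /legendre_vec [LHS]cE /= -/y lE pairingZl.
by rewrite pairing_cotan_tan// mulrA.
Qed.

Variable g : E1 -> R.
Hypothesis hg : forall a, chart_image ch q.1 a.1 -> legendre_coef a (g a).

Lemma legendre_coef_center_gt0 : 0 < g a0.
Proof. by have [] := hg (chart_image_center hM q.1 : chart_image ch q.1 a0.1). Qed.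

Lemma legendre_coef_center w :
  'D_w (F q.1) (legendre_vec q) = g a0 * pairing (covector q a0) w.
Proof.
have [_] := hg (chart_image_center hM q.1 : chart_image ch q.1 a0.1).
rewrite from_HsM_center//= from_center// => <-.
by rewrite tan_trans1 ?mulmx1//; exact: om_at hM q.1.
Qed.

Lemma differentiable_covector_pairing (w : 'rV[R]_m.+1) (a : E1) :
  differentiable (fun b => pairing (covector q b) w) a.
Proof.
set i := pivot (ray_repr q.2); set s := Num.sg (ray_repr q.2 0 i).
rewrite (_ : (fun b => _) =
    \sum_j ((fun b : E1 => covector q b 0 j) * cst (w 0 j))); last first.
  by apply/funext => b; rewrite pairingE fct_sumE.
apply: differentiable_sum => j; apply: differentiableM; last exact: differentiable_cst.
rewrite /covector -/i -/s; have [k jk|->] := unliftP i j; last first.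
  rewrite (_ : (fun b => _) = cst s); first exact: differentiable_cst.
  by apply/funext => b; rewrite affine_vec_pivot.
rewrite (_ : (fun b => _) = (fun t : 'rV[R]_m => t 0 k) \o (@snd 'rV[R]_m.+1 'rV[R]_m)).
  apply: differentiable_comp; first exact: differentiable_snd.
  exact: differentiable_coord.
by apply/funext => b; rewrite mxE jk liftK.
Qed.

Lemma continuous_covector_pairing (w : 'rV[R]_m.+1) (a : E1) :
  {for (w, a), continuous (fun z : 'rV[R]_m.+1 * E1 => pairing (covector q z.2) z.1)}.
Proof.
rewrite (_ : (fun z => _) = \sum_j (((fun b => pairing (covector q b) (delta_mx 0 j)) \o
    (@snd 'rV[R]_m.+1 E1)) * ((fun w : 'rV[R]_m.+1 => w 0 j) \o (@fst _ E1)))); last first.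
  apply/funext => z; rewrite pairingE fct_sumE; apply: eq_bigr => j _.
  by rewrite !fctE /= pairing_delta.
apply: differentiable_continuous; apply: differentiable_sum => j; apply: differentiableM.
  apply: differentiable_comp; first exact: differentiable_snd.
  exact: differentiable_covector_pairing.
apply: differentiable_comp; first exact: differentiable_fst.
exact: differentiable_coord.
Qed.

Lemma near_center (P : E1 -> Prop) : (forall a, chart_image ch q.1 a.1 -> P a) ->
  \forall a \near a0, P a.
Proof.
move=> HP; have qa : chart_image ch q.1 a0.1 by exact: chart_image_center.
exact: filterS HP (near_chart_image1 hM qa).
Qed.

(** By the fundamental inequality, with equality at the Legendre vector, g is the least quotient of
    F by the pairing over directions of positive pairing. [N] is F read in [ch q.1]; [T] and [S] are
    the inverse changes of fibre coordinates. *)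
Lemma continuous_legendre_coef : {for a0, continuous g}.
Proof.
pose N (w : 'rV[R]_m.+1) (a : E1) := TM_local ch F q.1 (a.1, w).
pose T (a : E1) := let y := from (ch q.1) a.1 in tan_trans ch q.1 y y.
pose S (a : E1) := let y := from (ch q.1) a.1 in tan_trans ch y q.1 y.
have TS a : chart_image ch q.1 a.1 -> T a *m S a = 1%:M.
  by move=> qa; rewrite /T /S tan_trans_mul//; [exact: from_dom | exact: om_at].
have ST a : chart_image ch q.1 a.1 -> S a *m T a = 1%:M.
  by move=> qa; rewrite /T /S tan_trans_mul//; [exact: om_at | exact: from_dom].
have mulTn0 a (w : 'rV[R]_m.+1) : chart_image ch q.1 a.1 -> w != 0 -> w *m T a != 0.
  move=> qa; apply: contra_neq => /(congr1 (mulmx^~ (S a))).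
  by rewrite -mulmxA TS// mulmx1 mul0mx.
apply: (@continuous_min_ratio _ _ _ N (fun w a => pairing (covector q a) w)).
- move=> w w1.
  apply: (continuous_comp (f := fun z : 'rV[R]_m.+1 * E1 => (z.2.1, z.1))
    (g := TM_local ch F q.1)).
    apply: differentiable_continuous; apply: differentiable_pair;
      last exact: differentiable_fst.
    apply: (@differentiable_comp _ _ _ _ snd fst); first exact: differentiable_snd.
    exact: differentiable_fst.
  exact: (@finsler_cont _ _ _ _ _ hF q.1 (a0.1, w) (chart_image_center hM q.1)).
- by move=> w _; exact: continuous_covector_pairing.
- apply: near_center => a qa w /sphere_neq0 w0.
  by apply: (finsler_gt0 hF); exact: mulTn0.
- by apply: near_center => a /hg[].
- apply: near_center => a qa w _; have [_ <-] := hg qa.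
  have v0 : legendre_vec (from_q a) != 0 by exact: ray_repr_neq0.
  exact: (@finsler_derive_le _ _ _ _ hM _ hF (from (ch q.1) a.1) _ (w *m T a) v0).
- apply: near_center => a qa; have [_ gE] := hg qa.
  set y := from (ch q.1) a.1 in gE; set v := legendre_vec _ in gE.
  have v0 : v != 0 by exact: ray_repr_neq0.
  (* The Legendre vector read in [ch q.1]; Euler's identity gives equality there. *)
  pose w := v *m S a; have wT : w *m T a = v by rewrite /w -mulmxA ST// mulmx1.
  have w0 : w != 0 by apply: contra_neq v0 => w0; rewrite -wT w0 mul0mx.
  exists (`|w|^-1 *: w); first exact: normalize_sphere.
  rewrite linearZ/= mulrCA -gE -[tan_trans _ _ _ _]/(T a) wT (finsler_derive_euler hF)//.
  rewrite /N /TM_local/= -/y -[tan_trans _ _ _ _]/(T a) -scalemxAl wT.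
  by rewrite (finsler_homog hF)// invr_gt0 normr_gt0.
Qed.

End contact_coefficient.

(** * The decomposition of the contact volume *)

Section ext_deriv_contact.
Context {R : realType} {m : nat} {M : topologicalType}.
Variable ch : M -> chart M 'rV[R]_m.+1.
Hypothesis hM : oriented_manifold ch.
Notation E1 := ('rV[R]_m.+1 * 'rV[R]_m)%type.
Variable q : M * ray R m.
Notation a0 := (to (HsM_chart ch q) q).
Notation from_q := (from (HsM_chart ch q)).
Notation transition a := (to (HsM_chart ch (from_q a)) \o from_q).

Lemma local_form_center k (omega : dform R (M * ray R m) E1 k) w :
  local_form (HsM_chart ch) omega q a0 w = omega q w.
Proof.
rewrite /local_form from_HsM_center//; congr (omega q _); apply/funext => i.
rewrite (near_eq_diff (g := id)); first by rewrite diff_val.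
by apply: near_center => // a; exact: HsM_fromK.
Qed.

(* Where a transition is not differentiable its differential is the junk value
   0, and a local expression of a form of positive degree vanishes there. *)
Lemma near_differentiable_transition k (omega : dform R (M * ray R m) E1 k) Z :
  is_form (HsM_chart ch) omega -> (0 < k)%N -> omega q Z != 0 ->
  \forall a \near a0, differentiable (transition a) a.
Proof.
move=> [olin _ osm] k0 oZ.
have /differentiable_continuous := osm q Z [::] a0 (HsM_center_image hM q).
rewrite /= -(local_form_center omega) in oZ *.
move=> /cvgr_neq0 /(_ oZ); apply: filterS => a.
apply: contra_neqP => Nd; apply: (multilinear0 (i := Ordinal k0) (olin _)).
by rewrite diff_eq0.
Qed.

Variable F : M -> 'rV[R]_m.+1 -> R.
Hypothesis hF : finsler ch F.
Variable g : E1 -> R.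
Hypothesis hg : forall a, chart_image ch q.1 a.1 -> legendre_coef ch F q a (g a).
Hypothesis contact : forall q' Z, contact_form ch F q' Z =
  'D_(Z ord0).1 (F q'.1) (legendre_vec ch F q').
Hypothesis dtrans : \forall a \near a0, differentiable (transition a) a.

Lemma near_local_contact : \forall a \near a0, forall w,
  local_form (HsM_chart ch) (contact_form ch F) q a w =
  g a * pairing (covector q a) (w ord0).1.
Proof.
have qa0 : \forall a \near a0, chart_image ch q.1 a.1 by exact: near_center.
apply: filterS2 qa0 dtrans => a qa da w.
by rewrite /local_form contact diff_HsM_transition//; have [_ ->] := hg qa.
Qed.

(** This is dtheta at the centre of the chart, evaluated on constant vector fields. *)
Definition contact_curvature : kform R E1 2 := fun Z =>
  \sum_(i < 2) (-1) ^+ i *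
    'D_(Z i) (fun a => pairing (covector q a) (Z (lift i ord0)).1) a0.

(** The functions theta(Z i) vanish at the centre, so differentiating g theta(Z i) there leaves no
    term in the derivative of g. *)
Lemma ext_deriv_contact Z : (forall i, pairing (covector q a0) (Z i).1 = 0) ->
  ext_deriv (HsM_chart ch) (contact_form ch F) q Z = g a0 * contact_curvature Z.
Proof.
move=> Z0; rewrite /ext_deriv /contact_curvature big_distrr/=.
apply: eq_bigr => i _; rewrite mulrCA; congr (_ * _).
have dh : derivable (fun a => pairing (covector q a) (Z (lift i ord0)).1) a0 (Z i).
  by apply: diff_derivable; exact: differentiable_covector_pairing.
rewrite -(derive_mul_eq0 (continuous_legendre_coef hM hF hg) dh (Z0 _)).
by apply: near_eq_derive; apply: filterS near_local_contact => a; exact.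
Qed.

End ext_deriv_contact.

Section decomposition.
Context {R : realType} {m : nat} {M : topologicalType}.
Variable ch : M -> chart M 'rV[R]_m.+1.
Hypothesis hM : oriented_manifold ch.
Notation E1 := ('rV[R]_m.+1 * 'rV[R]_m)%type.

Section frame.
Variable q : M * ray R m.
Notation a0 := (to (HsM_chart ch q) q).
Notation i0 := (pivot (ray_repr q.2)).
Notation kappa := (covector q a0).

(** A basis of the tangent space, sheared from the canonical one, whose members other than the pivot
    lie in the kernel of [kappa]. *)
Definition shear (j : 'I_m.+1) : 'rV[R]_m.+1 :=
  if j == i0 then delta_mx 0 i0
  else delta_mx 0 j - (kappa 0 j / kappa 0 i0) *: delta_mx 0 i0.

Lemma kappa_pivot : kappa 0 i0 != 0.
Proof.
by rewrite affine_vec_pivot sgr_eq0 pivot_neq0// ray_repr_neq0.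
Qed.

Lemma pairing_shear j : j != i0 -> pairing kappa (shear j) = 0.
Proof.
move=> ji; rewrite /shear (negPf ji); move: kappa kappa_pivot => p p0.
by rewrite linearB linearZ/= !pairing_delta [X in _ - X]divfK ?subrr.
Qed.

Variable Z0 : 'I_m -> E1.
Hypothesis Z0v : forall i, vertical ch q (Z0 i).

(** First m vertical vectors, then lifts of the m + 1 vectors of [shear]. It is a sequence over
    [nat] so that forms of degrees m + (m + 1) and 1 + 2m can both be evaluated on it. *)
Definition frame (k : nat) : E1 :=
  if insub k is Some i then Z0 i else (shear (inord (k - m)), 0).

Lemma frame_vertical (i : 'I_m) : frame i = Z0 i.
Proof. by rewrite /frame valK. Qed.

Lemma frame_horizontal (j : 'I_m.+1) : frame (m + j) = (shear j, 0).
Proof. by rewrite /frame insubN ?addKn ?inord_val// -leqNgt leq_addr. Qed.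

Lemma frame_kernel k : (k < m + m.+1)%N -> k != (m + i0)%N ->
  pairing kappa (frame k).1 = 0.
Proof.
move=> kmm ki; have [km|mk] := ltnP k m.
  have := Z0v (Ordinal km); rewrite /vertical tangent_HsM_proj//.
  by rewrite -(frame_vertical (Ordinal km)) => ->; rewrite linear0.
have jm : (k - m < m.+1)%N by rewrite ltn_subLR.
have kE : k = (m + Ordinal jm)%N by rewrite /= subnKC.
rewrite kE frame_horizontal pairing_shear//.
by apply: contra_neq ki => <-.
Qed.

End frame.

Variables (F : M -> 'rV[R]_m.+1 -> R) (beta : dform R (M * ray R m) E1 m)
  (Omega : dform R M 'rV[R]_m.+1 m.+1).
Hypothesis hF : finsler ch F.
Hypothesis hb : coangle_volume ch F beta Omega.

Notation omega q := (pullback (HsM_chart ch) ch (@HsM_proj R m M) Omega q).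

Lemma pullback_volumeE q w : omega q w = Omega q.1 (fun i => (w i).1).
Proof.
by rewrite /pullback; congr (Omega _ _); apply/funext => i; rewrite tangent_HsM_proj.
Qed.

Lemma multilinear_volume q : multilinear (omega q).
Proof.
have [[olin _ _] _] := coangle_volume_form hb.
move=> w i c u v; rewrite !pullback_volumeE.
have := olin q.1 (fun i => (w i).1) i c u.1 v.1.
have E (x : E1) : (fun k => ([eta w with i |-> x] k).1) =
    [eta (fun i => (w i).1) with i |-> x.1] :> ('I_m.+1 -> _).
  by apply/funext => k /=; case: eqP.
by rewrite !E.
Qed.

Lemma alternate_volume q : alternate (omega q).
Proof.
have [[_ oalt _] _] := coangle_volume_form hb.
move=> w i j ij wij; rewrite !pullback_volumeE; apply: (oalt _ _ i j) => //.
by rewrite wij.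
Qed.

Lemma vertical_volume_eq0 q (Z0 : 'I_m -> E1) (h : 'I_m.+1 -> 'I_(m + m.+1)) i j :
  (forall i, vertical ch q (Z0 i)) -> h i = lshift m.+1 j ->
  omega q ((fun k : 'I_(m + m.+1) => frame q Z0 k) \o h) = 0.
Proof.
move=> Z0v hij; rewrite pullback_volumeE.
have [[olin _ _] _] := coangle_volume_form hb.
apply: (multilinear0 (i := i) (olin _)); rewrite /= hij/= frame_vertical.
by have := Z0v j; rewrite /vertical tangent_HsM_proj.
Qed.

(** The pullback of Omega kills vertical vectors, so the wedge splits into blocks: [beta] on [Z0],
    and Omega on the sheared basis, where it has its positive value on the canonical basis. *)
Lemma decomposition_neq0 q (Z0 : 'I_m -> E1) :
  (forall i, vertical ch q (Z0 i)) -> beta q Z0 != 0 ->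
  wedge (beta q) (omega q) (fun i => frame q Z0 i) != 0.
Proof.
move=> Z0v bZ0; have [blin balt _] := coangle_form hb.
have [[olin oalt _] o_gt0] := coangle_volume_form hb.
apply: wedge_block_neq0 => //.
- by move=> h i j; exact: vertical_volume_eq0.
- exact: multilinear_volume.
- exact: alternate_volume.
- rewrite [X in beta q X](_ : _ = Z0)//; apply/funext => i /=.
  exact: frame_vertical.
- rewrite pullback_volumeE [X in Omega _ X](_ : _ = shear q).
    by rewrite alternate_shear// gt_eqF// o_gt0.
  by apply/funext => j /=; rewrite frame_horizontal.
Qed.

(** If the contact form vanished at [q], so would the right-hand side of the decomposition, whose
    left-hand side is nonzero on the frame. *)
Lemma contact_formE_coangle q Z : contact_form ch F q Z =
  'D_(Z ord0).1 (F q.1) (legendre_vec ch F q).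
Proof.
have [c0|] := contact_formE hM hF q; last exact.
have [Z0 Z0v bZ0] := coangle_neq0 hb q.
have := decomposition_neq0 Z0v bZ0.
rewrite (coangle_decomp hb q (frame q Z0)) /wedge big1 ?mulr0 ?eqxx// => s _.
by rewrite c0 mulr0 mul0r.
Qed.

(** One factor [c] comes from B and m factors from dB. Only the frame vector of index m + pivot lies
    outside the kernel of theta. *)
Lemma contact_volume q (Z0 : 'I_m -> E1) : (forall i, vertical ch q (Z0 i)) ->
  beta q Z0 != 0 ->
  let kappa := covector q (to (HsM_chart ch q) q) in
  exists c : R, [/\ 0 < c,
    forall w, 'D_w (F q.1) (legendre_vec ch F q) = c * pairing kappa w &
    wedge (beta q) (omega q) (fun i => frame q Z0 i) =
    c ^+ m.+1 * wedge (fun w : 'I_1 -> E1 => pairing kappa (w ord0).1)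
      (wedge_pow (contact_curvature ch q) m) (fun i => frame q Z0 i)].
Proof.
move=> Z0v bZ0 kappa; have [g hg] := exists_legendre_coef hM hF q.
have gE := legendre_coef_center hM hg.
exists (g (to (HsM_chart ch q) q)); split; [|exact: gE|].
  exact: (legendre_coef_center_gt0 hM hg).
rewrite (coangle_decomp hb q (frame q Z0)) exprS.
have km : (m + pivot (ray_repr q.2) < 1 + m * 2)%N.
  have -> : (1 + m * 2 = m + m.+1)%N by rewrite add1n muln2 -addnn addnS.
  by rewrite ltn_add2l.
apply: (@wedge_scale _ _ (fun z => pairing kappa z.1 = 0) _ _ _ _ _ _ _ _ (Ordinal km)).
- by move=> z; rewrite contact_formE_coangle gE.
- by [].
- move=> z Pz; apply: (wedge_pow_scale (P := fun z => pairing kappa z.1 = 0)) => //.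
  move=> m0 z' Pz'.
  apply: ext_deriv_contact => //; first exact: contact_formE_coangle.
  exact: near_differentiable_transition (coangle_form hb) m0 bZ0.
- move=> i ik; apply: frame_kernel => //.
  by rewrite addnS addnn -muln2 -add1n.
Qed.

End decomposition.

(** * Uniqueness *)

Section uniqueness.
Context {R : realType} {m : nat} {M : topologicalType}.
Variable ch : M -> chart M 'rV[R]_m.+1.
Hypothesis hM : oriented_manifold ch.

(** Both metrics give the same value on the frame, c^(m+1) X = c1^(m+1) X, where X is nonzero and
    does not involve the metric; positive (m+1)-st roots being unique, c = c1. *)
Lemma eq_legendre_derive (F F1 : M -> 'rV[R]_m.+1 -> R)
    (beta beta1 : dform R (M * ray R m) ('rV[R]_m.+1 * 'rV[R]_m) m)
    (Omega Omega1 : dform R M 'rV[R]_m.+1 m.+1) :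
  finsler ch F -> finsler ch F1 ->
  coangle_volume ch F beta Omega -> coangle_volume ch F1 beta1 Omega1 ->
  (forall q Z, (forall i, vertical ch q (Z i)) -> beta q Z = beta1 q Z) ->
  (forall x Z, Omega x Z = Omega1 x Z) ->
  forall q w, 'D_w (F q.1) (legendre_vec ch F q) =
    'D_w (F1 q.1) (legendre_vec ch F1 q).
Proof.
move=> hF hF1 hb hb1 eq_beta eq_Omega q w.
have [Z0 Z0v bZ0] := coangle_neq0 hb q.
have [c [c0 -> cX]] := contact_volume hM hF hb Z0v bZ0.
have b1Z0 : beta1 q Z0 != 0 by rewrite -eq_beta.
have [c1 [c10 -> c1X]] := contact_volume hM hF1 hb1 Z0v b1Z0.
congr (_ * _).
have eq_lhs : wedge (beta q) (pullback (HsM_chart ch) ch (@HsM_proj R m M) Omega q)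
      (fun i => frame ch q Z0 i) =
    wedge (beta1 q) (pullback (HsM_chart ch) ch (@HsM_proj R m M) Omega1 q)
      (fun i => frame ch q Z0 i).
  have -> : pullback (HsM_chart ch) ch (@HsM_proj R m M) Omega1 q =
      pullback (HsM_chart ch) ch (@HsM_proj R m M) Omega q.
    by apply/funext => Z; rewrite /pullback eq_Omega.
  apply: eq_wedge_block => [h i j hij|h].
    exact: (vertical_volume_eq0 hM hb Z0v hij).
  by apply: eq_beta => i /=; rewrite frame_vertical.
have := decomposition_neq0 hM hb Z0v bZ0.
rewrite cX mulf_eq0 negb_or => /andP[_ X0].
move: eq_lhs; rewrite cX c1X => /(mulIf X0)/eqP.
by rewrite eqrXn2// ?ltW// => /eqP.
Qed.

(** Duality at [w]: F(w) = D_w F(w) = k D_w F(v') = k D_w F1(v1) <= k F1(w) <= F1(w), where v' and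
    v1 are the Legendre vectors of [q] for F and F1. *)
Lemma finsler_le_of_eq_legendre_derive (F F1 : M -> 'rV[R]_m.+1 -> R) x v :
  finsler ch F -> finsler ch F1 ->
  (forall q w, 'D_w (F q.1) (legendre_vec ch F q) =
    'D_w (F1 q.1) (legendre_vec ch F1 q)) ->
  F x v <= F1 x v.
Proof.
move=> hF hF1 eq_D; have [->|v0] := eqVneq v 0.
  by rewrite (_ : F x 0 = 0) ?(finsler_ge0 hF1)//; exact/(finsler_eq0 hF).
pose p : M * ray R m := (x, ray_of v); pose w := ray_repr p.2.
have w0 : w != 0 by exact: ray_repr_neq0.
have [l l0 wE] := ray_repr_of v0.
rewrite -(ler_pM2l l0) -(finsler_homog hF)// -(finsler_homog hF1)// -wE -/w.
pose q := legendre ch F p; pose p' := legendre_inv ch F q.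
have qx : q.1 = x by rewrite /q legendreE.
have p'x : p'.1 = x by rewrite /p' legendre_inv1.
have v'0 : legendre_vec ch F q != 0 by exact: ray_repr_neq0.
(* The chosen preimage [p'] of [q] may differ from [p], but their gradients span the same ray. *)
have [k k0 kE] : exists2 k : R, 0 < k & gradient F p = k *: gradient F p'.
  have := legendre_invK hM hF q; rewrite -/p' /q !legendreE// => /(congr1 snd)/= E.
  have [k k0 kE] := ray_repr_of (gradient_neq0 hM hF p).
  have [k' k'0 k'E] := ray_repr_of (gradient_neq0 hM hF p').
  exists (k^-1 * k'); first by rewrite mulr_gt0// invr_gt0.
  by rewrite -scalerA -k'E E kE scalerA mulVf ?scale1r// gt_eqF.
have DE u : 'D_u (F x) w = k * 'D_u (F x) (legendre_vec ch F q).
  have := gradientE hM hF p u; rewrite -/w => ->.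
  by rewrite kE pairingZl -(gradientE hM hF) p'x.
(* Test the fundamental inequality at [w] on v': D_v' F(w) = k F(v') is at most F(v'). *)
have k1 : k <= 1.
  rewrite -(ler_pM2r (finsler_gt0 hF x v'0)) mul1r.
  rewrite -{1}(finsler_derive_euler hF x v'0) -DE.
  exact: (finsler_derive_le hM hF _ _ w0).
have := eq_D q w; rewrite qx => eq_Dw.
rewrite -(finsler_derive_euler hF x w0) DE eq_Dw.
have v10 : legendre_vec ch F1 q != 0 by exact: ray_repr_neq0.
apply: le_trans (_ : k * F1 x w <= _).
  by rewrite ler_pM2l//; exact: (finsler_derive_le hM hF1 _ _ v10).
by rewrite ler_piMl// (finsler_ge0 hF1).
Qed.

End uniqueness.

Theorem corollary1p3p12 (R : realType) (m : nat) (M : topologicalType)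
    (ch : M -> chart M 'rV[R]_m.+1) (hM : oriented_manifold ch)
    (F F1 : M -> 'rV[R]_m.+1 -> R) (hF : finsler ch F) (hF1 : finsler ch F1)
    (beta beta1 : dform R (M * ray R m) ('rV[R]_m.+1 * 'rV[R]_m) m)
    (Omega Omega1 : dform R M 'rV[R]_m.+1 m.+1)
    (hbeta : coangle_volume ch F beta Omega)
    (hbeta1 : coangle_volume ch F1 beta1 Omega1)
    (eq_beta : forall (q : M * ray R m)
      (Z : 'I_m -> 'rV[R]_m.+1 * 'rV[R]_m),
      (forall i, vertical ch q (Z i)) -> beta q Z = beta1 q Z)
    (eq_Omega : forall x Z, Omega x Z = Omega1 x Z) :
  forall x v, F x v = F1 x v.
Proof.
have eq_D := eq_legendre_derive hM hF hF1 hbeta hbeta1 eq_beta eq_Omega.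
move=> x v; apply/eqP; rewrite eq_le.
rewrite (finsler_le_of_eq_legendre_derive hM x v hF hF1 eq_D)/=.
apply: (finsler_le_of_eq_legendre_derive hM x v hF1 hF) => q w.
by rewrite eq_D.
Qed.
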